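(* Let $\mathbb{T}$ be a time scale and $t_0<t_1$ points of $\mathbb{T}$. Let $K(t)=\{x\in\mathbb{R}^n:b_i(t)<x_i<c_i(t),\ i=1,\dots,n\}$ for $t\in\mathbb{T}$, where $b_i,c_i:\mathbb{T}\to\mathbb{R}$, $i=1,\dots,n$, are delta differentiable functions on $\mathbb{T}$ with $b_i(t)<c_i(t)$ for each $t\in\mathbb{T}$. Let $f$, $U$, a fixed control $u$, and $f_u=(f_1,\dots,f_n):\mathbb{T}\times\mathbb{R}^n\to\mathbb{R}^n$ be as in the context, and let $F(t,x)=\{f(t,x,w):w\in U\}$ for $(t,x)\in Graph(K)$. If every point $M\in\partial Graph(K)$ is a delta-point of strict egress for the set $Graph(K)$ with respect to the system $x^\Delta(t)=f_u(t,x(t))$, then there exists $\overline{x}\in K(t_0)$ such that the initial value problem $$x^\Delta(t)\in F(t,x(t)),\qquad x(t_0)=\overline{x},$$ has a solution $x=\overline{x}(t)$ satisfying $(t,\overline{x}(t))\in Graph(K)$ for every $t\in[t_0,t_1]_{\mathbb{T}}$.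
   Context: A time scale $\mathbb{T}$ is a nonempty closed subset of $\mathbb{R}$, with forward jump operator $\sigma$, backward jump operator $\rho$, and delta derivative denoted ${}^\Delta$. $\mathbb{T}^\kappa=\mathbb{T}\setminus\{\sup\mathbb{T}\}$ if $\sup\mathbb{T}$ is finite and left-scattered, and $\mathbb{T}^\kappa=\mathbb{T}$ otherwise; delta derivatives on $\mathbb{T}$ are taken at points of $\mathbb{T}^\kappa$. A function on $\mathbb{T}$ is rd-continuous if it is continuous at right-dense points and has finite left-sided limits at left-dense points. $[t_0,t_1]_{\mathbb{T}}=[t_0,t_1]\cap\mathbb{T}$. ''Almost everywhere'' refers to the Lebesgue $\Delta$-measure. Notation for $K$: $Graph(K)=\{(t,x):t\in\mathbb{T},\ x\in K(t)\}$; $\overline{K(t)}=\{x\in\mathbb{R}^n:b_i(t)\le x_i\le c_i(t),\ i=1,\dots,n\}$; $\partial K(t)=\overline{K(t)}\setminus K(t)$; $\partial Graph(K)=\{(t,x):t\in\mathbb{T},\ x\in\partial K(t)\}$. Control system: $x^\Delta(t)=f(t,x(t),u(t))$, where $U\subset\mathbb{R}^m$ is compact, the admissible controls are the $\Delta$-measurable, piecewise rd-continuous functions $u$ with $u(t)\in U$ for all $t\in\mathbb{T}$, and $f:Graph(K)\times U\to\mathbb{R}^n$ is rd-continuous with respect to the first variable and continuously differentiable with respect to the second variable $x\in\mathbb{R}^n$. An admissible control $u$ is fixed, and $f_u:\mathbb{T}\times\mathbb{R}^n\to\mathbb{R}^n$ is the resulting right-hand side, so $f_u(t,x)=f(t,x,u(t))$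 for $(t,x)\in Graph(K)$. Standing assumptions on $f_u$: $f_u$ is continuous; and for every non-isolated point $t\in\mathbb{T}$ there are a closed set $S_t\subseteq\mathbb{T}\times\mathbb{R}^n$ and a number $r>0$ with $\inf\mathbb{T}\le t-r$, $\sup\mathbb{T}\ge t+r$ and $([t-r,t+r]\cap\mathbb{T})\times\overline{K(t)}\subset S_t$, such that $f_u$ is rd-continuous, bounded and Lipschitz continuous on $S_t$. Delta-points of strict egress: for $i\in\{1,\dots,n\}$ let $Graph(K)^i_B=\{(t,x):t\in\mathbb{T},\ x\in\overline{K(t)},\ x_i=b_i(t)\}$ and $Graph(K)^i_C=\{(t,x):t\in\mathbb{T},\ x\in\overline{K(t)},\ x_i=c_i(t)\}$, so that $\partial Graph(K)=\bigcup_{i=1}^n(Graph(K)^i_B\cup Graph(K)^i_C)$. A point $M=(t,x)\in Graph(K)^i_B$ is a delta-point of strict egress for $Graph(K)$ with respect to $x^\Delta=f_u(t,x)$ if $f_i(M)<b_i^\Delta(t)$; a point $M=(t,x)\in Graph(K)^i_C$ is one if $f_i(M)>c_i^\Delta(t)$. ''Every point of $\partial Graph(K)$ is a delta-point of strict egress'' means that the corresponding inequality holds at every point of every face $Graph(K)^i_B$, $Graph(K)^i_C$, $i=1,\dots,n$ (at $t\in\mathbb{T}^\kappa$, where the delta derivatives are defined). A solution of the inclusion initial value problem is an absolutely continuous (''absolutely rd-continuous'') function $x:[t_0,t_1]_{\mathbb{T}}\to\mathbb{R}^n$ with $x(t_0)=\overline{x}$ and $x^\Delta(t)\in F(t,x(t))$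 for almost every $t\in[t_0,t_1]_{\mathbb{T}}$. *)

(* Defs.v *)
From mathcomp Require Import all_boot all_order all_algebra.
From mathcomp Require Import all_classical all_reals all_analysis.

Set Implicit Arguments.
Unset Strict Implicit.
Unset Printing Implicit Defensive.

Import Order.TTheory GRing.Theory Num.Theory.
Import numFieldNormedType.Exports.

Local Open Scope classical_set_scope.
Local Open Scope ring_scope.

(* Functions on a time scale T (or on a subset of T) are total functions on R;
   only their values on T are ever used. *)

Section TimeScale.
Variables (R : realType) (T : set R).

Definition time_scale : Prop := T !=set0 /\ closed T.

(* The usual conventions inf set0 = sup T and sup set0 = inf T are written out,
   because the library's inf and sup are 0 on the empty set. *)
Definition sigma (t : R) : R :=
  if pselect ([set s | T s /\ t < s] !=set0)
  then inf [set s | T s /\ t < s] else sup T.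

Definition rho (t : R) : R :=
  if pselect ([set s | T s /\ s < t] !=set0)
  then sup [set s | T s /\ s < t] else inf T.

Definition left_scattered (t : R) : Prop := T t /\ rho t < t.

(* A maximum of T is not right-dense, a minimum is not left-dense. *)
Definition right_dense (t : R) : Prop :=
  [/\ T t, exists2 s, T s & t < s & sigma t = t].

Definition left_dense (t : R) : Prop :=
  [/\ T t, exists2 s, T s & s < t & rho t = t].

(* As T is closed, a finite supremum of T is a maximum of T. *)
Definition kappa : set R :=
  T `\` [set t | (forall s, T s -> s <= t) /\ left_scattered t].

Definition is_delta_derive (V : normedModType R) (g : R -> V) (t : R) (d : V) :
    Prop :=
  forall e : R, 0 < e -> exists2 r : R, 0 < r &
    forall s, T s -> `|t - s| < r ->
      `|g (sigma t) - g s - (sigma t - s) *: d| <= e * `|sigma t - s|.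

Definition delta_derivable (V : normedModType R) (g : R -> V) (t : R) : Prop :=
  exists d, is_delta_derive g t d.

(* The delta derivative is unique at every point of kappa. *)
Definition delta_derive (V : normedModType R) (g : R -> V) (t : R) : V :=
  get [set d | is_delta_derive g t d].

(* The density of t is relative to T, the limits are taken along A `<=` T. *)
Definition rd_continuous_on (V : normedModType R) (A : set R) (g : R -> V) :
    Prop :=
  forall t, A t ->
    (right_dense t -> g @ within A (nbhs t) --> g t) /\
    (left_dense t -> cvg (g @ within A t^'-)).

(* The exceptional points form a set D that is finite in every bounded
   interval; at these points the one-sided limits still exist. *)
Definition piecewise_rd_continuous (V : normedModType R) (g : R -> V) : Prop :=
  exists2 D : set R, forall a b : R, finite_set (D `&` `[a, b]) &
    forall t, T t ->
      [/\ right_dense t -> ~ D t -> g @ within T (nbhs t) --> g t,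
          right_dense t -> cvg (g @ within T t^'+) &
          left_dense t -> cvg (g @ within T t^'-)].

(* Outer measure generated by the length b - a of the half-open intervals
   [a, b[ of T; it is +oo on sets that are not covered by such intervals. *)
Definition delta_outer (A : set R) : \bar R :=
  ereal_inf [set z | exists a b : nat -> R,
    [/\ forall k, [/\ T (a k), T (b k) & a k <= b k],
        A `<=` \bigcup_k (T `&` `[a k, b k[) &
        z = (\sum_(0 <= k <oo) (b k - a k)%:E)%E]].

Definition delta_measurable (A : set R) : Prop :=
  A `<=` T /\ delta_outer.-caratheodory A.

Definition delta_measurable_fun (V : normedModType R) (g : R -> V) : Prop :=
  forall O : set V, open O -> delta_measurable (T `&` g @^-1` O).

Definition delta_negligible (A : set R) : Prop := delta_outer A = 0%E.

Definition delta_absolutely_continuous (V : normedModType R) (g : R -> V) :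
    Prop :=
  forall e : R, 0 < e -> exists2 r : R, 0 < r &
    forall (N : nat) (a b : 'I_N -> R),
      (forall k, [/\ T (a k), T (b k) & a k <= b k]) ->
      trivIset setT (fun k => T `&` `[a k, b k[) ->
      \sum_(k < N) (b k - a k) < r ->
      \sum_(k < N) `|g (b k) - g (a k)| < e.

(* Rd-continuity, on S `<=` T * V, of a function of two variables: composing
   it with any continuous x : T -> V gives an rd-continuous function of t
   (as long as (t, x t) stays in S). *)
Definition rd_continuous2_on (V W : normedModType R) (S : set (R * V))
    (g : R -> V -> W) : Prop :=
  forall x : R -> V, {within T, continuous x} ->
    rd_continuous_on [set t | S (t, x t)] (fun t => g t (x t)).

End TimeScale.

Section Tube.
Variables (R : realType) (n : nat) (T : set R) (b c : 'I_n -> R -> R).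

Definition tube (t : R) : set 'rV[R]_n :=
  [set x | forall i, b i t < x ord0 i < c i t].

Definition tube_closure (t : R) : set 'rV[R]_n :=
  [set x | forall i, b i t <= x ord0 i <= c i t].

Definition tube_boundary (t : R) : set 'rV[R]_n := tube_closure t `\` tube t.

Definition graph : set (R * 'rV[R]_n) := [set M | T M.1 /\ tube M.1 M.2].

Definition graph_boundary : set (R * 'rV[R]_n) :=
  [set M | T M.1 /\ tube_boundary M.1 M.2].

Definition lower_face (i : 'I_n) : set (R * 'rV[R]_n) :=
  [set M | [/\ T M.1, tube_closure M.1 M.2 & M.2 ord0 i = b i M.1]].

Definition upper_face (i : 'I_n) : set (R * 'rV[R]_n) :=
  [set M | [/\ T M.1, tube_closure M.1 M.2 & M.2 ord0 i = c i M.1]].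

(* M may lie on several faces; the inequality is required on each of them. *)
Definition delta_strict_egress (g : R -> 'rV[R]_n -> 'rV[R]_n)
    (M : R * 'rV[R]_n) : Prop :=
  forall i,
    (lower_face i M -> g M.1 M.2 ord0 i < delta_derive T (b i : R -> R^o) M.1) /\
    (upper_face i M -> delta_derive T (c i : R -> R^o) M.1 < g M.1 M.2 ord0 i).

(* Lipschitz continuity is meant in the space variable. *)
Definition locally_regular (g : R -> 'rV[R]_n -> 'rV[R]_n) : Prop :=
  forall t, T t -> ~ isolated T t ->
    exists (S : set (R * 'rV[R]_n)) (r : R),
      [/\ closed S /\ S `<=` T `*` setT,
          [/\ 0 < r, (ereal_inf (EFin @` T) <= (t - r)%:E)%E &
              ((t + r)%:E <= ereal_sup (EFin @` T))%E],
          (T `&` `[t - r, t + r]) `*` tube_closure t `<=` S &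
          [/\ rd_continuous2_on T S g,
              exists B : R, forall M, S M -> `|g M.1 M.2| <= B &
              exists L : R, forall s x y, S (s, x) -> S (s, y) ->
                `|g s x - g s y| <= L * `|x - y|]].

End Tube.

Section ControlSystem.
Variables (R : realType) (n m : nat) (T : set R) (b c : 'I_n -> R -> R).
Variables (U : set 'rV[R]_m) (f : R -> 'rV[R]_n -> 'rV[R]_m -> 'rV[R]_n).

Definition admissible_control (u : R -> 'rV[R]_m) : Prop :=
  [/\ delta_measurable_fun T u, piecewise_rd_continuous T u &
      forall t, T t -> U (u t)].

Definition rd_continuous_time : Prop :=
  forall x w, U w ->
    rd_continuous_on T [set t | graph T b c (t, x)] (fun t => f t x w).

Definition continuously_differentiable_space : Prop :=
  forall t w, T t -> U w ->
    (forall x, tube b c t x -> differentiable (fun y => f t y w) x) /\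
    {within tube b c t, continuous (jacobian (fun y => f t y w))}.

Definition rhs_set (t : R) (x : 'rV[R]_n) : set 'rV[R]_n :=
  [set f t x w | w in U].

End ControlSystem.

(* x is a function on the time scale J = [t0, t1] `&` T: its delta derivative
   is the one relative to J, taken at the points of kappa J. *)
Definition inclusion_solution (R : realType) (n : nat) (T : set R) (t0 t1 : R)
    (F : R -> 'rV[R]_n -> set 'rV[R]_n) (x0 : 'rV[R]_n) (x : R -> 'rV[R]_n) :
    Prop :=
  let J := T `&` `[t0, t1] in
  [/\ delta_absolutely_continuous J x,
      x t0 = x0 &
      delta_negligible T [set t | kappa J t /\
        ~ (delta_derivable J x t /\ F t (x t) (delta_derive J x t))]].

(* Main.v *)
(** On each step of a partition the Euler map x |-> x + h g(tau, x) sends the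
    faces of the closed box K(s) outside the closed box K(s'), by strict egress
    at the tag tau; by the Poincare-Miranda theorem it therefore covers K(s').
    Going backwards from a point of K(t1), this yields eps-approximate solutions
    that stay near the closed tube.  A limit as eps -> 0 is a solution in the
    closed tube, and it cannot touch the boundary at any t < t1, since it would
    leave the closed tube right after t.  As fu is continuous, the solution is
    delta differentiable at every point, with derivative fu t (x t).

    Poincare-Miranda comes from a cubical Sperner lemma: if h_i is 0 on the face
    x_i = 0 and 1 on the opposite face, the cochain dh_1 u ... u dh_n over F_2
    evaluates to 1 on Kuhn's triangulation of the cube, because it is the
    coboundary of h_1 u dh_2 u ... u dh_n and only the face x_1 = N contributes
    to the boundary term. *)

Require Import Defs.
From mathcomp Require Import all_boot all_order all_algebra all_fingroup.
From mathcomp Require Import all_classical all_reals all_analysis.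
From mathcomp Require Import zify ring lra.

Import Order.TTheory GRing.Theory Num.Theory.
Import numFieldNormedType.Exports.

Set Implicit Arguments.
Unset Strict Implicit.
Unset Printing Implicit Defensive.

Local Open Scope classical_set_scope.
Local Open Scope ring_scope.

(** * A cubical Sperner lemma *)

(** Strict egress expels forward trajectories, so nothing singles out a good initial point by
    stepping forward. Prescribing the terminal value turns egress into a covering property of
    sections, and coverings compose along a partition. Two obstacles shape the steps. The delta
    derivatives of [b] and [c] exist pointwise but need not be continuous, so the admissible step
    length depends on the tag [tau] and need not have a positive lower bound; the partition
    therefore comes from a supremum argument, with the tag between the two ends of its step. At a
    left-dense, right-scattered [tau] the derivative only encodes the jump, so a step that starts
    slightly before [tau] carries an error, kept proportional to its length. In the combinatorial
    part, coefficients mod 2 remove all orientation signs, and one bit per coordinate is exactly the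
    sign information that a vector field provides. *)

Section CubicalSperner.
Variables (n N : nat) (h : 'I_n -> {ffun 'I_n -> nat} -> bool).
Hypothesis h0 : forall i (q : {ffun 'I_n -> nat}), q i = 0%N -> h i q = false.
Hypothesis hN : forall i (q : {ffun 'I_n -> nat}), q i = N.+1 -> h i q = true.

Let H i q : 'F_2 := (h i q)%:R.

(* The simplex of [p] and [s] starts at the corner [p] of a unit cube and adds
   1 to the coordinates [s 0], [s 1], ... in turn. *)
Definition kuhn_vertex (p : {ffun 'I_n -> 'I_N.+1}) (s : 'S_n) (i : nat) :
    {ffun 'I_n -> nat} := [ffun c => p c + ((s^-1)%g c < i)]%N.
Let v := kuhn_vertex.

Let addFF (x : 'F_2) : x + x = 0.
Proof. by case: x => [[|[|]]] // i; apply/val_inj. Qed.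

(** When [fixl k s] and [face k p] hold, the vertices of index at least [k] have their first [k]
    coordinates equal to [N.+1]: the tail of the path is a simplex of that face of the grid. *)
Let fixl (k : nat) (s : 'S_n) := [forall c : 'I_n, (c < k)%N ==> (s c == c)].
Let face (k : nat) (p : {ffun 'I_n -> 'I_N.+1}) :=
  [forall c : 'I_n, (c < k)%N ==> (p c == N :> nat)].

(** Both are factors of a cup product evaluated along the path: [low_prod] reads the coboundary of
    [h i] on the edge that enters vertex [i], [high_prod] on the edge that leaves it. *)
Let low_prod k j p s := \prod_(i < n | (k < i <= j)%N)
  (H i (v p s i) + H i (v p s i.-1)).
Let high_prod j p s := \prod_(i < n | (j <= i)%N)
  (H i (v p s i.+1) + H i (v p s i)).
(* The face where the coordinates [c < k] equal [N.+1], with the remaining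
   coboundaries [k], ..., [n.-1]. *)
Let face_sum k := \sum_(p | face k p) \sum_(s | fixl k s) high_prod k p s.

Lemma v_swap (p : {ffun 'I_n -> 'I_N.+1}) (s : 'S_n) (a b : 'I_n) (i : nat) :
  b = a.+1 :> nat -> i != b :> nat ->
  v p (tperm a b * s)%g i = v p s i.
Proof.
move=> ab ib; apply/ffunP => c; rewrite !ffunE invMg tpermV permM; congr (_ + _)%N.
case: tpermP => [->|->|//]; lia.
Qed.

Lemma fixl_swap k (s : 'S_n) (a b : 'I_n) : (k <= a)%N -> (k <= b)%N ->
  fixl k (tperm a b * s)%g = fixl k s.
Proof.
move=> ka kb; apply: eq_forallb => c; case: ltnP => //= ck.
by rewrite permM tpermD // -val_eqE /=; lia.
Qed.

(** The transposition pairs even with odd permutations; the paired terms are equal and cancel in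
    characteristic 2. *)
Lemma swap_sum0 k (F : 'S_n -> 'F_2) (a b : 'I_n) :
  a != b -> (k <= a)%N -> (k <= b)%N ->
  (forall s, F (tperm a b * s)%g = F s) -> \sum_(s | fixl k s) F s = 0.
Proof.
move=> ab ka kb FE; rewrite (bigID (fun s => odd_perm s)) /=.
rewrite (reindex_inj (mulgI (tperm a b))) /=.
under eq_bigl do rewrite fixl_swap // odd_permM odd_tperm ab addTb.
under eq_bigr do rewrite FE.
exact: addFF.
Qed.

Lemma low_prod_rec k (j : 'I_n) p s : (k < j)%N ->
  low_prod k j p s = (H j (v p s j) + H j (v p s j.-1)) * low_prod k j.-1 p s.
Proof.
move=> kj; rewrite /low_prod (bigD1 j) /= ?kj ?leqnn //; congr (_ * _).
by apply: eq_bigl => i; rewrite -val_eqE /=; lia.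
Qed.

Lemma high_prod_rec (j : 'I_n) p s :
  high_prod j p s = (H j (v p s j.+1) + H j (v p s j)) * high_prod j.+1 p s.
Proof.
rewrite /high_prod (bigD1 j) /= ?leqnn //; congr (_ * _).
by apply: eq_bigl => i; rewrite -val_eqE /=; lia.
Qed.

(* Swapping two adjacent directions changes a single vertex, so what does not
   involve that vertex cancels mod 2: these are the faces interior to a cube. *)
Lemma low_high_exchange k (K : 'I_n) p : K = k :> nat ->
  forall j, (k + j < n)%N ->
  \sum_(s | fixl k s) H K (v p s k) * high_prod k.+1 p s =
  \sum_(s | fixl k s) H K (v p s k) * (low_prod k (k + j) p s * high_prod (k + j).+1 p s).
Proof.
move=> Kk; elim=> [|j IH] jn.
  apply: eq_bigr => s _; rewrite addn0 /low_prod big_pred0 ?mul1r // => i; lia.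
rewrite IH; last by lia.
have jn' : (k + j < n)%N by lia.
pose a := Ordinal jn'; pose b := Ordinal jn.
apply/eqP; rewrite -subr_eq0 -sumrB; apply/eqP.
apply: (@swap_sum0 k _ a b); rewrite -?val_eqE /=; try lia.
move=> s.
(* Leibniz rule: consecutive products differ by the value on the face that omits vertex [b], where
   the coboundary of [h b] is read on the edge from [b.-1] to [b.+1]. Swapping the directions [a]
   and [b] leaves it unchanged. *)
have E s' : H K (v p s' k) * (low_prod k (k + j) p s' * high_prod (k + j).+1 p s') -
  H K (v p s' k) * (low_prod k (k + j.+1) p s' * high_prod (k + j.+1).+1 p s') =
  H K (v p s' k) * (low_prod k (k + j) p s' * high_prod (k + j.+1).+1 p s' *
   (H b (v p s' b.+1) - H b (v p s' b.-1))).
  have -> : (k + j).+1 = b :> nat by rewrite /=; lia.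
  have -> : (k + j.+1)%N = b by [].
  rewrite (@low_prod_rec k b); last by rewrite /=; lia.
  rewrite (high_prod_rec b).
  have -> : b.-1 = (k + j)%N :> nat by rewrite /=; lia.
  ring.
rewrite !E; congr (H _ _ * (_ * _ * (H _ _ - H _ _))).
- by apply: v_swap => /=; lia.
- apply: eq_bigr => i /andP[ki ij].
  by congr (H _ _ + H _ _); apply: v_swap => /=; lia.
- apply: eq_bigr => i ij.
  by congr (H _ _ + H _ _); apply: v_swap => /=; lia.
- by apply: v_swap => /=; lia.
- by apply: v_swap => /=; lia.
Qed.


(** Moves position [K] to the end. In the rotated order the step [s K] comes last, so the face
    without the last vertex is a translate by one unit, in direction [s K], of the face without
    vertex [K] in the original order. *)
Let rot_fun (K x : 'I_n) : nat :=
  if (x < K)%N then nat_of_ord x else if x == K :> nat then n.-1 else x.-1.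

Lemma rot_fun_lt K x : (rot_fun K x < n)%N.
Proof. by rewrite /rot_fun; have := ltn_ord x; case: ifP => //; case: ifP => //; lia. Qed.

Let rot_ord K x := Ordinal (rot_fun_lt K x).

Lemma rot_inj K : injective (rot_ord K).
Proof.
move=> x y /(congr1 val); rewrite /= /rot_fun /= => e; apply/val_inj; move: e => /=.
have := ltn_ord x; have := ltn_ord y.
by repeat (case: ifP => ?); lia.
Qed.

Let rot K : 'S_n := perm (@rot_inj K).

(** Vertices translated by -1 in direction [d]. The truncated subtraction is harmless for [d = s K]
    and [i > K], as that coordinate has already been raised. *)
Let w (p : {ffun 'I_n -> 'I_N.+1}) (s : 'S_n) (d : 'I_n) i : {ffun 'I_n -> nat} :=
  [ffun c => p c + ((s^-1)%g c < i) - (c == d)]%N.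

Lemma v_rot (p : {ffun 'I_n -> 'I_N.+1}) (s : 'S_n) (K : 'I_n)
    (i : nat) : (K <= i < n)%N ->
  v p ((rot K)^-1 * s)%g i = w p s (s K) i.+1.
Proof.
move=> Ki; apply/ffunP => c; rewrite !ffunE invMg invgK permM permE /=.
have -> : (c == s K) = ((s^-1)%g c == K :> nat).
  by rewrite -[c == _](inj_eq (@perm_inj _ s^-1%g)) permK.
rewrite /rot_fun; have := ltn_ord ((s^-1)%g c).
move: (nat_of_ord (p c)) (nat_of_ord ((s^-1)%g c)) => a y.
by repeat (case: ifP => /= ?); lia.
Qed.

Lemma fixl_rot (K : 'I_n) (s : 'S_n) : fixl K ((rot K)^-1 * s)%g = fixl K s.
Proof.
apply: eq_forallb => c; case: ltnP => //= ck.
rewrite permM; suff -> : (rot K)^-1%g c = c by [].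
apply/(@perm_inj _ (rot K)); rewrite permKV permE; apply/val_inj.
by rewrite /= /rot_fun ck.
Qed.

Let rot_term p (s : 'S_n) (K : 'I_n) := H K (w p s (s K) K.+1) *
  \prod_(i < n | (K < i)%N) (H i (w p s (s K) i.+1) + H i (w p s (s K) i)).

Lemma rotate_sum (K : 'I_n) p :
  \sum_(s | fixl K s) H K (v p s K) * low_prod K n.-1 p s =
  \sum_(s | fixl K s) rot_term p s K.
Proof.
rewrite (reindex_inj (mulgI (rot K)^-1%g)) /=.
under eq_bigl do rewrite fixl_rot.
apply: eq_bigr => s _; rewrite v_rot ?leqnn ?ltn_ord // /rot_term; congr (_ * _).
apply: eq_big => [i|i /andP[Ki _]]; first by have := ltn_ord i; lia.
have := ltn_ord i => iltn.
rewrite !v_rot; [|lia|lia].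
by congr (_ + H i (w _ _ _ _)); lia.
Qed.

(** Cyclic, hence a bijection on base points; the wrap from [N] to 0 matches the two opposite sides
    of the grid, where the labels are prescribed. *)
Let shift (d : 'I_n) (p : {ffun 'I_n -> 'I_N.+1}) : {ffun 'I_n -> 'I_N.+1} :=
  [ffun c => if c == d then ordS (p c) else p c].

Lemma shift_inj d : injective (shift d).
Proof.
move=> p q /ffunP e; apply/ffunP => c; have := e c; rewrite !ffunE.
by case: ifP => // _ /ordS_inj.
Qed.

Lemma face_shift (K : 'I_n) (s : 'S_n) p : fixl K s -> face K (shift (s K) p) = face K p.
Proof.
move=> /forallP fs; apply: eq_forallb => c; case: ltnP => //= ck; rewrite ffunE.
case: (c =P s K) => // cd; have := fs c; rewrite ck /= => /eqP sc.
have /perm_inj cK : s c = s K by exact: (etrans sc cd).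
by rewrite cK ltnn in ck.
Qed.

Lemma w_shift (p : {ffun 'I_n -> 'I_N.+1}) (s : 'S_n) (K : 'I_n)
    (i : nat) : (K < i)%N -> (p (s K) < N)%N ->
  w (shift (s K) p) s (s K) i = v p s i.
Proof.
move=> Ki pN; apply/ffunP => c; rewrite !ffunE; case: eqP => [->|_] /=; last by rewrite subn0.
by rewrite permK Ki modn_small //; lia.
Qed.

Lemma w_shiftN (p : {ffun 'I_n -> 'I_N.+1}) (s : 'S_n) (K : 'I_n)
    (i : nat) : (K < i)%N ->
  p (s K) = N :> nat ->
  w (shift (s K) p) s (s K) i (s K) = 0%N.
Proof.
by move=> Ki pN; rewrite !ffunE eqxx permK Ki /= pN modnn.
Qed.

Lemma v_N (p : {ffun 'I_n -> 'I_N.+1}) (s : 'S_n) (K : 'I_n)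
    (i : nat) : (K < i)%N ->
  p (s K) = N :> nat ->
  v p s i (s K) = N.+1.
Proof. by move=> Ki pN; rewrite !ffunE permK Ki /= pN addn1. Qed.

(* A face orthogonal to the direction [s K] is shared by two adjacent cubes,
   except on the boundary of the grid. *)
Lemma pair_shift (K : 'I_n) (s : 'S_n) p : fixl K s ->
  H K (v p s K.+1) * high_prod K.+1 p s + rot_term (shift (s K) p) s K =
  if (s K == K) && (p K == N :> nat) then high_prod K.+1 p s else 0.
Proof.
move=> fs; have [pN|pN] := eqVneq (p (s K) : nat) N; last first.
  have pN' : (p (s K) < N)%N by have := ltn_ord (p (s K)); lia.
  have -> : rot_term (shift (s K) p) s K = H K (v p s K.+1) * high_prod K.+1 p s.
    rewrite /rot_term w_shift //; congr (_ * _); apply: eq_bigr => i Ki.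
    by rewrite !w_shift //; lia.
  rewrite addFF; case: eqP => //= sK; rewrite -sK.
  by case: eqP => // e; rewrite e eqxx in pN.
(* On the top side [h K] is 1 and on the bottom side it is 0, so only the top term survives. *)
have [sK|sK] := eqVneq (s K) K.
  have pK : p K = N :> nat by move: pN; rewrite sK.
  have := v_N (ltnSn K) pN; have := w_shiftN (ltnSn K) pN.
  rewrite /rot_term sK pK eqxx /= => w0 v1.
  by rewrite /H (h0 w0) (hN v1) mul0r mul1r addr0.
(* Both products contain the coboundary of [h (s K)] on an edge inside a side orthogonal to [s K],
   where this label is constant; both terms vanish. *)
have Ks : (K < s K)%N.
  rewrite ltnNge; apply/negP => sKK.
  have := forallP fs (s K); rewrite ltn_neqAle sKK andbT.
  rewrite val_eqE sK /= => /eqP /perm_inj e; by rewrite e eqxx in sK.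
have -> : high_prod K.+1 p s = 0.
  rewrite /high_prod (bigD1 (s K)) //= /H !(hN (v_N _ pN)) //; last by lia.
  by rewrite addFF mul0r.
rewrite mulr0 add0r /rot_term (bigD1 (s K)) //= /H !(h0 (w_shiftN _ pN)) //; last by lia.
by rewrite addFF mul0r mulr0.
Qed.

Lemma face_sum_rec (K : 'I_n) : face_sum K = face_sum K.+1.
Proof.
rewrite {1}/face_sum.
(* The first summand is the face opposite to the first vertex; the second is traded for the face
   opposite to the last one, with [n.-1 - K] the exchange index that turns every edge factor into a
   [low_prod] factor. *)
under eq_bigr => p _.
  under eq_bigr do rewrite high_prod_rec mulrDl.
  rewrite big_split /=.
  have Kn : (K + (n.-1 - K) < n)%N by have := ltn_ord K; lia.
  rewrite (low_high_exchange _ (erefl (K : nat)) Kn).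
  have -> : (K + (n.-1 - K))%N = n.-1 by have := ltn_ord K; lia.
  under [X in _ + X]eq_bigr => s _.
    rewrite [X in _ * (_ * X)]big_pred0 ?mulr1; last by move=> i; have := ltn_ord i; lia.
    over.
  rewrite rotate_sum -big_split /=.
  over.
rewrite exchange_big /=.
under eq_bigr => s fs.
  rewrite big_split /= [X in _ + X](reindex_inj (@shift_inj (s K))) /=.
  under [X in _ + X]eq_bigl do rewrite face_shift //.
  rewrite -big_split /=.
  under eq_bigr do rewrite pair_shift //.
  over.
rewrite exchange_big /= /face_sum.
rewrite big_mkcond [RHS]big_mkcond /=; apply: eq_bigr => p _.
have faceE : face K.+1 p = face K p && (p K == N :> nat).
  apply/forallP/andP => [f|[/forallP f pK] c].
    split; last by have := f K; rewrite leqnn.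
    by apply/forallP => c; apply/implyP => cK; have := f c; rewrite ltnW.
  apply/implyP; rewrite ltnS leq_eqVlt => /orP[/eqP/val_inj ->//|cK].
  by have := f c; rewrite cK.
have fixE s : fixl K.+1 s = fixl K s && (s K == K).
  apply/forallP/andP => [f|[/forallP f pK] c].
    split; last by have := f K; rewrite leqnn.
    by apply/forallP => c; apply/implyP => cK; have := f c; rewrite ltnW.
  apply/implyP; rewrite ltnS leq_eqVlt => /orP[/eqP/val_inj ->//|cK].
  by have := f c; rewrite cK.
rewrite faceE; case: ifP => //= fp; last first.
case: eqP => pK; last first.
  by rewrite big1 // => s _; rewrite andbF.
under [RHS]eq_bigl do rewrite fixE.
by rewrite big_mkcondr /=; apply: eq_bigr => s _; rewrite andbT.
Qed.

Lemma face_sum_const k : (k <= n)%N -> face_sum k = face_sum 0.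
Proof.
elim: k => // k IH kn; rewrite -IH; last exact: ltnW.
by rewrite (face_sum_rec (Ordinal kn)).
Qed.

Lemma face_sum_n : face_sum n = 1.
Proof.
rewrite /face_sum (big_pred1 [ffun=> ord_max]); last first.
  move=> p; apply/forallP/eqP => [f|-> c]; last by rewrite ffunE /= eqxx implybT.
  apply/ffunP => c; rewrite ffunE; apply/val_inj; have := f c.
  by rewrite ltn_ord => /eqP.
rewrite (big_pred1 1%g); last first.
  move=> s; apply/forallP/eqP => [f|-> c]; last by rewrite perm1 eqxx implybT.
  by apply/permP => c; rewrite perm1; have := f c; rewrite ltn_ord => /eqP.
by rewrite /high_prod big_pred0 // => i; rewrite leqNgt ltn_ord.
Qed.

(** [face_sum 0] counts mod 2 the simplices on which each [h i] changes along the [i]-th edge of the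
    path. The count is odd, so one exists, and its vertices all lie in the cube at [p]. *)
Lemma cubical_sperner : exists p : {ffun 'I_n -> 'I_N.+1}, forall i,
  exists q q' : {ffun 'I_n -> nat},
    [/\ forall c, (p c <= q c <= (p c).+1)%N,
        forall c, (p c <= q' c <= (p c).+1)%N, ~~ h i q & h i q'].
Proof.
have := face_sum_const (leqnn n); rewrite face_sum_n => /esym S0.
have : face_sum 0 != 0 by rewrite S0 oner_neq0.
rewrite /face_sum => Snz.
have /existsP[p /existsP[s]] : [exists p, [exists s, high_prod 0 p s != 0]].
  apply: contraNT Snz => /existsPn nB; apply/eqP/big1 => p _; apply: big1 => s _.
  by apply/eqP; move/existsPn: (nB p) => /(_ s); rewrite negbK.
move=> /prodf_neq0 Bps; exists p => i.
have vb j c : (p c <= v p s j c <= (p c).+1)%N.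
  by rewrite ffunE; case: (_ < _)%N => /=; lia.
have := Bps i isT; rewrite /H.
case hi: (h i (v p s i.+1)); case hj: (h i (v p s i)).
- by rewrite addFF eqxx.
- by exists (v p s i), (v p s i.+1); rewrite hi hj.
- by exists (v p s i.+1), (v p s i); rewrite hi hj.
- by rewrite addFF eqxx.
Qed.

End CubicalSperner.

(** * The Poincare-Miranda theorem *)

Lemma le_norm_coord (R : realType) n (x : 'rV[R]_n) i : `|x ord0 i| <= `|x|.
Proof.
by rewrite [leRHS]/Num.norm /= mx_normrE; apply/bigmax_geP; right; exists (ord0, i).
Qed.

Lemma norm_le_coord (R : realType) n (x : 'rV[R]_n) e :
  0 <= e -> (forall i, `|x ord0 i| <= e) -> `|x| <= e.
Proof.
move=> e0 xe; rewrite [leLHS]/Num.norm /= mx_normrE.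
by apply/bigmax_leP; split=> // -[i j] _; rewrite (ord1 i).
Qed.

Lemma compact_unif_continuous (R : realType) (X Y : pseudoMetricType R)
    (A : set X) (f : X -> Y) :
  compact A -> {within A, continuous f} ->
  forall e, 0 < e -> exists2 d : R, 0 < d &
    forall x y, A x -> A y -> ball x d y -> ball (f x) e (f y).
Proof.
move=> cA /subspace_continuousP fc e e0.
pose P (d : R) x := forall y, A y -> ball x d y -> ball (f x) e (f y).
have : \forall d \near 0^'+, A `<=` P d.
  apply: (near_covering_withinP A).2; first exact/compact_near_coveringP.
  move=> x Ax.
  have /fc/(_ _ (nbhsx_ballx _ (e / 2) _)) := Ax.
  move=> /(_ _)/[!divr_gt0]//; rewrite /= => /(_ isT).
  rewrite nbhs_filterE /= => /nbhs_ballP[r /= r0 rP].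
  have r20 : 0 < r / 2 by rewrite divr_gt0.
  exists (ball x (r / 2), [set d | 0 < d < r / 2]) => /=.
    split; first exact: nbhsx_ballx.
    by near=> d; apply/andP; split; near: d; [exact: nbhs_right_gt|exact: nbhs_right_lt].
  move=> [x' d] /= [xx' /andP[d0 dr]] Ax' y Ay x'y.
  have fx' : ball (f x) (e / 2) (f x').
    by apply: rP => //; apply: le_ball xx'; rewrite ler_pdivrMr// ler_peMr ?ltW// ltr1n.
  have fy : ball (f x) (e / 2) (f y).
    apply: rP => //; rewrite (splitr r); apply: ball_triangle xx' _.
    exact/le_ball/x'y/ltW.
  by rewrite (splitr e); apply: ball_triangle fy; exact: ball_sym.
move=> /nbhs_ballP[r /= r0 rP]; exists (r / 2); first by rewrite divr_gt0.
move=> x y Ax Ay; apply: rP => //; last by rewrite divr_gt0.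
rewrite /ball /= sub0r normrN gtr0_norm ?divr_gt0//.
by rewrite ltr_pdivrMr// ltr_pMr// ltr1n.
Unshelve. all: by end_near. Qed.

Section PoincareMiranda.
Variables (R : realType) (n : nat).

Definition unit_cube : set 'rV[R]_n := [set l | forall i, 0 <= l ord0 i <= 1].

Lemma compact_unit_cube : compact unit_cube.
Proof.
have := @rV_compact R n (fun=> `[0, 1]%classic) (fun=> @segment_compact _ _ _).
by congr compact; apply/seteqP; split=> l lQ i; have := lQ i; rewrite /= in_itv.
Qed.

Lemma unit_cube_nonempty : unit_cube !=set0.
Proof. by exists 0 => i; rewrite mxE lexx ler01. Qed.

Variable F : 'rV[R]_n -> 'rV[R]_n.
Hypothesis Fc : {within unit_cube, continuous F}.
Hypothesis F0 : forall l i, unit_cube l -> l ord0 i = 0 -> F l ord0 i <= 0.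
Hypothesis F1 : forall l i, unit_cube l -> l ord0 i = 1 -> 0 <= F l ord0 i.

(** Truncation keeps the point in the cube for every [q], since labels are defined on unbounded
    indices. *)
Let point N (q : {ffun 'I_n -> nat}) : 'rV[R]_n :=
  \row_c ((minn (q c) N.+1)%:R / N.+1%:R).

Lemma point_cube N q : unit_cube (point N q).
Proof.
move=> i; rewrite mxE; apply/andP; split; first by rewrite divr_ge0.
by rewrite ler_pdivrMr// mul1r ler_nat geq_minr.
Qed.

Lemma approximate_zero e : 0 < e -> exists2 l, unit_cube l & `|F l| <= e.
Proof.
move=> e0.
have [d d0 dP] := compact_unif_continuous compact_unit_cube Fc (divr_gt0 e0 (ltr0n R 2)).
pose N := Num.truncn (d^-1); have Nd : N.+1%:R^-1 < d.
  by rewrite invf_plt ?posrE// /N truncnS_gt.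
(* The label is the sign of [F i], forced on the two faces, where the boundary conditions are only
   weak inequalities; these still give the sign that a forced label announces. *)
pose h (i : 'I_n) (q : {ffun 'I_n -> nat}) : bool :=
  (0 < q i)%N && ((N < q i)%N || (0 < F (point N q) ord0 i)).
have [||p hp] := @cubical_sperner n N h.
- by move=> i q; rewrite /h => ->.
- by move=> i q; rewrite /h => ->; rewrite ltnSn.
pose q0 : {ffun 'I_n -> nat} := [ffun c => p c : nat].
have close (q : {ffun 'I_n -> nat}) : (forall c, (p c <= q c <= (p c).+1)%N) ->
    `|F (point N q0) - F (point N q)| <= e / 2.
  move=> qp; apply/ltW.
  have := dP _ _ (point_cube N q0) (point_cube N q).
  rewrite -!ball_normE /ball_ /=; apply; apply: le_lt_trans Nd.
  apply: norm_le_coord; first by rewrite invr_ge0.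
  move=> c; rewrite !mxE ffunE -mulrBl normrM [X in _ * X]gtr0_norm ?invr_gt0//.
  rewrite ler_piMl ?invr_ge0//; have := qp c; have := ltn_ord (p c).
  set a := minn (p c) N.+1; set b := minn (q c) N.+1 => pN /andP[pq qp1].
  rewrite distrC ger0_norm ?subr_ge0 ?ler_nat /a /b; last lia.
  rewrite lerBlDl natr1 ler_nat; lia.
exists (point N q0); first exact: point_cube.
apply: norm_le_coord => [|i]; first exact: ltW.
have [q [q' [qp qp' hq hq']]] := hp i.
have Fq : F (point N q) ord0 i <= 0.
  move: hq; rewrite /h negb_and -eqn0Ngt negb_or -!leNgt.
  case/orP=> [/eqP qi|/andP[_ ->//]].
  by apply: F0; [exact: point_cube|rewrite mxE qi min0n mul0r].
have Fq' : 0 <= F (point N q') ord0 i.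
  move: hq'; rewrite /h => /andP[_ /orP[Nq|/ltW//]].
  apply: F1; first exact: point_cube.
  by rewrite mxE (minn_idPr Nq) divff.
have := le_trans (le_norm_coord _ i) (close _ qp).
have := le_trans (le_norm_coord _ i) (close _ qp').
rewrite !mxE !ler_norml; lra.
Qed.

Lemma poincare_miranda : exists2 l, unit_cube l & F l = 0.
Proof.
have Nc : {within unit_cube, continuous (fun l => `|F l|)}.
  apply/subspace_continuousP => l Ql; apply: cvg_norm.
  by move/subspace_continuousP: Fc; apply.
have [l /set_mem Ql lmin] :=
  compact_EVT_min unit_cube_nonempty compact_unit_cube Nc.
exists l => //; apply/eqP; rewrite -normr_le0; apply/ler_addgt0Pl => e e0.
have [l' Ql' Fl'] := approximate_zero e0.
by rewrite addr0; apply: le_trans (lmin _ (mem_set Ql')) Fl'.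
Qed.

End PoincareMiranda.

(** * Time scales *)

Lemma finite_pos (R : realType) n (P : 'I_n -> R -> Prop) :
  (forall i e e', 0 < e' <= e -> P i e -> P i e') ->
  (forall i, exists2 e, 0 < e & P i e) -> exists2 e, 0 < e & forall i, P i e.
Proof.
move=> Pmono Pex.
have : \forall e \near 0^'+, forall i, P i e.
  apply: filter_forall => i; have [e e0 Pe] := Pex i.
  near=> e'; apply: Pmono Pe; apply/andP; split; near: e'.
    exact: nbhs_right_gt.
  exact: nbhs_right_le.
move=> nearP; near (0 : R)^'+ => e; exists e; first by [].
by near: e.
Unshelve. all: by end_near. Qed.

Lemma compact_lt0_gap (R : realType) (X : topologicalType) (A : set X) (f : X -> R) :
  compact A -> {within A, continuous f} -> (forall x, A x -> f x < 0) ->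
  exists2 e, 0 < e & forall x, A x -> f x + e <= 0.
Proof.
move=> cA fc f0; have [->|/set0P A0] := eqVneq A set0; first by exists 1.
have [x /set_mem Ax xmax] := compact_EVT_max A0 cA fc.
exists (- f x); first by rewrite oppr_gt0 f0.
by move=> y Ay; rewrite subr_le0 xmax ?inE.
Qed.

Section TimeScaleLemmas.
Variables (R : realType) (T : set R).

Lemma sigma_le t s : T s -> t < s -> sigma T t <= s.
Proof.
move=> Ts ts; rewrite /sigma; case: pselect => [ne|[]] /=; last by exists s.
by apply: ge_inf => //; exists t => r /= [Tr /ltW].
Qed.

Lemma sigma_ge t : T t -> t <= sigma T t.
Proof.
move=> Tt; rewrite /sigma; case: pselect => [ne|nne].
  by apply: lb_le_inf => // r /= [Tr /ltW].
apply: ub_le_sup => //; exists t => r Tr; rewrite leNgt; apply/negP => tr.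
by apply: nne; exists r.
Qed.

Lemma sigma_max t : T t -> (forall s, T s -> s <= t) -> sigma T t = t.
Proof.
move=> Tt tmax; rewrite /sigma; case: pselect => [[s [Ts]]|nex] /=.
  by rewrite ltNge tmax.
apply/eqP; rewrite eq_le; apply/andP; split; first by apply: ge_sup => //; exists t.
by apply: ub_le_sup => //; exists t.
Qed.

Lemma sigma_dense t d : T t -> sigma T t = t -> (exists2 s, T s & t < s) ->
  0 < d -> exists2 s, T s & t < s < t + d.
Proof.
move=> Tt st [s Ts ts] d0.
have hi : has_inf [set s | T s /\ t < s].
  by split; [exists s | exists t => r /= [Tr /ltW]].
have := inf_adherent d0 hi.
have -> : inf [set s | T s /\ t < s] = t.
  by move: st; rewrite /sigma; case: pselect => /= [//|[]]; exists s.
by move=> [r [Tr tr] rtd]; exists r; rewrite // tr.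
Qed.

Lemma sigma_in t : closed T -> T t -> T (sigma T t).
Proof.
move=> cT Tt.
have [ex|nex] := pselect (exists2 s, T s & t < s); last first.
  rewrite sigma_max // => s Ts; rewrite leNgt; apply/negP => ts.
  by apply: nex; exists s.
apply: cT => U /nbhs_ballP[e /= e0 eU].
have [s Ts ts] := ex.
have hi : has_inf [set s | T s /\ t < s].
  by split; [exists s | exists t => r /= [Tr /ltW]].
have [r [Tr tr] re] := inf_adherent e0 hi.
have sE : sigma T t = inf [set s | T s /\ t < s].
  by rewrite /sigma; case: pselect => /= [//|[]]; exists s.
exists r; split=> //; apply: eU.
have := sigma_le Tr tr; rewrite -ball_normE /ball_ /= sE => ir.
by rewrite distrC ger0_norm ?subr_ge0 // ltrBlDl.
Qed.

Lemma rho_ge t s : T s -> s < t -> s <= rho T t.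
Proof.
move=> Ts st; rewrite /rho; case: pselect => [ne|[]] /=; last by exists s.
by apply: ub_le_sup => //; exists t => r /= [Tr /ltW].
Qed.

Lemma kappa_lt t s : T t -> T s -> t < s -> kappa T t.
Proof. by move=> Tt Ts ts; split=> // -[/(_ _ Ts)]; rewrite leNgt ts. Qed.

Section DeltaDerivative.
Variables (V : normedModType R) (g : R -> V).

Lemma delta_derive_scattered t d : T t -> is_delta_derive T g t d ->
  g (sigma T t) = g t + (sigma T t - t) *: d.
Proof.
move=> Tt gd; apply/eqP; rewrite -subr_eq0 opprD addrA -normr_le0.
apply/ler_addgt0Pl => e e0; rewrite addr0.
have s0 : 0 <= sigma T t - t by rewrite subr_ge0 sigma_ge.
(* Adding 1 keeps the denominator positive when [t] is right-dense. *)
have e'0 : 0 < e / (sigma T t - t + 1) by rewrite divr_gt0 // ltr_wpDl.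
have [r r0 rP] := gd _ e'0.
apply: le_trans (rP _ Tt _) _; first by rewrite subrr normr0.
rewrite ger0_norm // mulrAC -mulrA ler_piMr ?ltW // ltr_pdivrMr ?ltr_wpDl //.
by rewrite mul1r ltrDl.
Qed.

Lemma delta_derive_continuous t d : T t -> is_delta_derive T g t d ->
  forall e, 0 < e -> exists2 r : R, 0 < r &
    forall s, T s -> `|t - s| < r -> `|g t - g s| <= e.
Proof.
move=> Tt gd e e0.
have s0 : 0 <= sigma T t - t by rewrite subr_ge0 sigma_ge.
have m0 : 0 < sigma T t - t + 1 by rewrite ltr_wpDl.
have n0 : 0 < `|d| + 1 by rewrite ltr_wpDl.
have [r r0 rP] := gd _ (divr_gt0 (divr_gt0 e0 (ltr0n R 2)) m0).
(* The bound 1 on [|t - s|] gives [|sigma T t - s| <= sigma T t - t + 1]; the last bound controls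
   the linear term. *)
exists (Num.min r (Num.min 1 (e / 2 / (`|d| + 1)))).
  by rewrite !lt_min r0 ltr01 !divr_gt0.
move=> s Ts; rewrite !lt_min => /and3P[tsr ts1 tsd].
have -> : g t - g s = (g (sigma T t) - g s - (sigma T t - s) *: d) + (t - s) *: d.
  rewrite (delta_derive_scattered Tt gd).
  have -> : (sigma T t - s) *: d = (sigma T t - t) *: d + (t - s) *: d.
    by rewrite -scalerDl; congr (_ *: _); ring.
  by rewrite opprD !addrA subrK [g t + _ - g s]addrAC addrK.
apply: le_trans (ler_normD _ _) _; rewrite (splitr e) lerD //.
  apply: le_trans (rP _ Ts tsr) _.
  rewrite mulrAC -mulrA; apply: ler_piMr; first by rewrite ltW // divr_gt0.
  rewrite ler_pdivrMr // mul1r.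
  have -> : sigma T t - s = (sigma T t - t) + (t - s) by ring.
  by rewrite (le_trans (ler_normD _ _)) // (ger0_norm s0) lerD2l ltW.
rewrite normrZ.
have := ltW tsd; rewrite ler_pdivlMr //; apply: le_trans.
by rewrite ler_wpM2l // lerDl.
Qed.

End DeltaDerivative.
End TimeScaleLemmas.

(** * Continuity and compactness in normed modules *)

Lemma within_cvg_dist (R : realType) (V W : normedModType R) (A : set V)
    (f : V -> W) x :
  (forall e, 0 < e -> exists2 r : R, 0 < r &
    forall y, A y -> `|x - y| < r -> `|f x - f y| <= e) ->
  f @ within A (nbhs x) --> f x.
Proof.
move=> fP; apply/cvgrPdist_le => e e0; have [r r0 rP] := fP e e0.
apply/nbhs_ballP; exists r => //= y; rewrite -ball_normE /ball_ /= => xy Ay.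
exact: rP.
Qed.

Lemma within_cvg_distP (R : realType) (V W : normedModType R) (A : set V)
    (f : V -> W) x :
  f @ within A (nbhs x) --> f x ->
  forall e, 0 < e -> exists2 r : R, 0 < r &
    forall y, A y -> `|x - y| < r -> `|f x - f y| <= e.
Proof.
move=> /cvgrPdist_le fx e e0; have /nbhs_ballP[r /= r0 rP] := fx e e0.
by exists r => // y Ay xy; apply: rP => //; rewrite -ball_normE.
Qed.

Lemma continuous_dist (R : realType) (V W : normedModType R) (f : V -> W) :
  (forall x e, 0 < e -> exists2 r : R, 0 < r &
    forall y, `|x - y| < r -> `|f x - f y| <= e) ->
  continuous f.
Proof.
move=> fP x; apply/cvgrPdist_le => e /(fP x)[r r0 rP].
by apply/nbhs_ballP; exists r => //= y; rewrite -ball_normE; exact: rP.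
Qed.

Lemma continuous_sub (R : realType) (V W : normedModType R) (f h : V -> W) :
  continuous f -> continuous h -> continuous (fun x => f x - h x).
Proof. by move=> fc hc x; apply: cvgB; [exact: fc|exact: hc]. Qed.

Lemma euler_map_continuous (R : realType) (V W : normedModType R) (B : V -> W)
    (G : W -> W) (h : R) (y : W) : continuous B -> continuous G ->
  continuous (fun x => B x + h *: G (B x) - y).
Proof.
move=> Bc Gc x; apply: cvgB; last exact: cvg_cst.
apply: cvgD; first exact: Bc.
by apply: cvgZl_tmp; apply: (@cvg_comp _ _ _ B G); [exact: Bc|exact: Gc].
Qed.

Lemma ultra_compact_cvg (I : Type) (V : topologicalType) (U : set_system I)
    (A : set V) (f : I -> V) :
  UltraFilter U -> compact A -> (forall i, A (f i)) -> exists p : V, f @ U --> p.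
Proof.
move=> UU cA Af; have UF := @ultra_proper _ _ UU.
have fA : (f @ U) A by apply: (@filterS _ U _ setT); [move=> i _; exact: Af|exact: filterT].
have [p [_ clp]] := cA (f @ U) _ fA.
exists p => N Np; case: (in_ultra_setVsetC (f @^-1` N) UU) => // UN.
have fN : (f @ U) (~` N) by [].
by have [q []] := clp _ _ fN Np.
Qed.

(** Arzela-Ascoli through an ultrafilter finer than [\oo]: the pointwise limits exist at all [t] at
    once, with no diagonal extraction, and compactness of [J] with the common Lipschitz constant
    makes the convergence uniform. *)
Lemma equilipschitz_subsequence (R : realType) (V : normedModType R)
    (J : set R) (B : set V) (C : R) (z : nat -> R -> V) :
  compact J -> compact B -> (forall k t, J t -> B (z k t)) ->
  (forall k p q, J p -> J q -> `|z k p - z k q| <= C * `|p - q|) ->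
  exists y : R -> V, forall e, 0 < e -> forall N, exists2 k, (N <= k)%N &
    forall t, J t -> `|z k t - y t| <= e.
Proof.
move=> cJ cB zB zC.
have [U [UU ooU]] := @ultraFilterLemma nat \oo _.
have UF := @ultra_proper _ _ UU.
have /choice [y yP] : forall t, exists p : V, J t -> z ^~ t @ U --> p.
  move=> t; have [Jt|nJt] := pselect (J t); last by exists 0.
  by have [p zp] := ultra_compact_cvg UU cB (fun k => zB k t Jt); exists p.
exists y => e e0 N.
pose D := `|C| + 1; have D0 : 0 < D by rewrite ltr_wpDl.
have zD k p q : J p -> J q -> `|z k p - z k q| <= D * `|p - q|.
  move=> Jp Jq; apply: le_trans (zC k p q Jp Jq) _; rewrite ler_wpM2r //.
  by rewrite (le_trans (ler_norm _)) // lerDl.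
have yz t r : J t -> 0 < r -> \forall k \near U, `|z k t - y t| <= r.
  by move=> Jt r0; have /cvgrPdistC_le := yP t Jt; apply.
have yD p q : J p -> J q -> `|y p - y q| <= D * `|p - q|.
  move=> Jp Jq; apply/ler_addgt0Pr => r r0.
  have r20 : 0 < r / 2 by rewrite divr_gt0.
  have [k [kp kq]] := filter_ex (filterI (yz p _ Jp r20) (yz q _ Jq r20)).
  apply: le_trans (ler_distD (z k p) _ _) _; rewrite distrC.
  have := ler_distD (z k q) (z k p) (y q); have := zD k p q Jp Jq; lra.
have : \forall k \near U, J `<=` (fun t => `|z k t - y t| <= e).
  apply: (near_covering_withinP J).2; first exact/compact_near_coveringP.
  move=> t Jt; have e3 : 0 < e / 3 by rewrite divr_gt0.
  have e3D : 0 < e / 3 / D by rewrite divr_gt0.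
  exists (ball t (e / 3 / D), [set k | `|z k t - y t| <= e / 3]) => /=.
    by split; [exact: nbhsx_ballx|exact: yz].
  move=> [t' k] /= [tt' zk] Jt'.
  have tD : D * `|t - t'| <= e / 3.
    by rewrite mulrC -ler_pdivlMr // ltW //; move: tt'; rewrite -ball_normE.
  have h1 := le_trans (zD k t t' Jt Jt') tD.
  have h2 := le_trans (yD t t' Jt Jt') tD.
  apply: le_trans (ler_distD (z k t) _ _) _; rewrite distrC.
  by have := ler_distD (y t) (z k t) (y t'); lra.
move=> Uk; have UN : U [set k | (N <= k)%N] by apply: ooU; exists N.
by have [k [kN kP]] := filter_ex (filterI UN Uk); exists k.
Qed.

(** * Solutions in a tube with strict egress *)

Section StrictEgress.
Variables (R : realType) (n : nat) (T : set R) (t0 t1 : R).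
Variables (b c db dc : 'I_n -> R -> R) (g : R -> 'rV[R]_n -> 'rV[R]_n).
Hypotheses (closedT : closed T) (Tt0 : T t0) (Tt1 : T t1) (t01 : t0 < t1).
Hypothesis bD : forall i t, kappa T t ->
  is_delta_derive T (b i : R -> R^o) t (db i t).
Hypothesis cD : forall i t, kappa T t ->
  is_delta_derive T (c i : R -> R^o) t (dc i t).
Hypothesis bc : forall i t, T t -> b i t < c i t.
Hypothesis g_continuous : {within T `*` setT,
  continuous (fun M : R * 'rV[R]_n => g M.1 M.2)}.
Hypothesis lower_egress : forall i t x, kappa T t -> tube_closure b c t x ->
  x ord0 i = b i t -> g t x ord0 i < db i t.
Hypothesis upper_egress : forall i t x, kappa T t -> tube_closure b c t x ->
  x ord0 i = c i t -> dc i t < g t x ord0 i.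
(* If [t1] were left-dense and right-scattered, nothing would be known on the
   behaviour of [b] and [c] to the left of [t1]. *)
Hypothesis t1_end : left_scattered T t1 \/ sigma T t1 = t1.

Let J : set R := T `&` `[t0, t1].

Lemma in_J t : J t <-> T t /\ t0 <= t <= t1.
Proof. by rewrite /J /= in_itv. Qed.

Lemma compact_J : compact J.
Proof.
rewrite /J setIC; apply: compact_closedI => //; exact: segment_compact.
Qed.

(** In the second case [t1] is isolated in [J], so continuity at [t1] is trivial and no step begins
    near it other than at [t1] itself. *)
Lemma J_cases t : J t -> kappa T t \/ (t = t1 /\ left_scattered T t1).
Proof.
move=> /in_J[Tt /andP[_ tt1]].
have [tlt|t1t] := ltP t t1; first by left; exact: kappa_lt Tt Tt1 tlt.
have -> : t = t1 by apply/eqP; rewrite eq_le tt1.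
have [ls|nls] := pselect (left_scattered T t1); first by right.
by left; split=> // -[].
Qed.

Lemma J_left_scattered s : left_scattered T t1 -> J s -> rho T t1 < s -> s = t1.
Proof.
move=> [_ ls] /in_J[Ts /andP[_]]; rewrite le_eqVlt => /orP[/eqP//|st1].
by move=> /lt_le_trans/(_ (rho_ge Ts st1)); rewrite ltxx.
Qed.

Lemma J_continuous (h dh : R -> R) :
  (forall t, kappa T t -> is_delta_derive T (h : R -> R^o) t (dh t)) ->
  {within J, continuous h}.
Proof.
move=> hD; apply/subspace_continuousP => t Jt.
apply: (@within_cvg_dist R R^o R^o) => e e0.
have [kt|[-> ls]] := J_cases Jt.
  have [Tt _] := (in_J t).1 Jt.
  have [r r0 rP] := delta_derive_continuous Tt (hD _ kt) e0.
  by exists r => // s /in_J[Ts _]; exact: rP.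
exists (t1 - rho T t1); first by rewrite subr_gt0 ls.2.
move=> s Js; have [_ /andP[_ st1]] := (in_J s).1 Js.
rewrite ger0_norm ?subr_ge0 // ltrD2l ltrN2 => rs.
by rewrite (J_left_scattered ls Js rs) subrr normr0 ltW.
Qed.

Lemma tube_unif_continuous e : 0 < e -> exists2 r : R, 0 < r &
  forall s t, J s -> J t -> `|s - t| < r ->
  forall i, `|b i s - b i t| <= e /\ `|c i s - c i t| <= e.
Proof.
move=> e0.
have uc (h : 'I_n -> R -> R) : (forall i, {within J, continuous (h i)}) ->
    exists2 r : R, 0 < r & forall i s t, J s -> J t -> `|s - t| < r ->
    `|h i s - h i t| <= e.
  move=> hc; apply: (@finite_pos R n (fun i r => forall s t, J s -> J t ->
      `|s - t| < r -> `|h i s - h i t| <= e)).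
    move=> i r r' /andP[_ r'r] rP s t Js Jt st.
    by apply: rP => //; exact: lt_le_trans st r'r.
  move=> i; have [r r0 rP] := compact_unif_continuous compact_J (hc i) e0.
  exists r => // s t Js Jt st; apply/ltW.
  by have := rP s t Js Jt; rewrite -ball_normE; apply.
have [r r0 rP] := uc b (fun i => J_continuous (bD i)).
have [r' r'0 r'P] := uc c (fun i => J_continuous (cD i)).
exists (Num.min r r'); first by rewrite lt_min r0.
by move=> s t Js Jt; rewrite lt_min => /andP[sr sr'] i; rewrite rP ?r'P.
Qed.

Lemma tube_bounded : exists2 M : R, 0 < M & forall t, J t ->
  forall i, `|b i t| <= M /\ `|c i t| <= M.
Proof.
have bd (h : 'I_n -> R -> R) : (forall i, {within J, continuous (h i)}) ->
    exists M : 'I_n -> R, forall i t, J t -> `|h i t| <= M i.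
  move=> hc; suff /choice[M MP] : forall i, exists M, forall t, J t -> `|h i t| <= M.
    by exists M.
  move=> i.
  have J0 : J !=set0 by exists t0; apply/in_J; rewrite lexx ltW.
  have hn : {within J, continuous (fun t => `|h i t|)}.
    apply/subspace_continuousP => t Jt; apply: cvg_norm.
    by move/subspace_continuousP: (hc i); apply.
  have [t _ tmax] := compact_EVT_max J0 compact_J hn.
  by exists `|h i t| => s Js; apply: tmax; rewrite inE.
have [M MP] := bd b (fun i => J_continuous (bD i)).
have [M' M'P] := bd c (fun i => J_continuous (cD i)).
(* A common bound over all [i] is obtained as the inverse of a common positive threshold. *)
have [e e0 eP] : exists2 e, 0 < e & forall i, M i <= e^-1 /\ M' i <= e^-1.
  apply: finite_pos => [i e e' /andP[e'0 ee'] [Me Me']|i].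
    have ee'V : e^-1 <= e'^-1 by rewrite lef_pV2 ?posrE // (lt_le_trans e'0).
    by split; [exact: le_trans Me ee'V|exact: le_trans Me' ee'V].
  exists (`|M i| + `|M' i| + 1)^-1; first by rewrite invr_gt0 ltr_wpDl // addr_ge0.
  have := ler_norm (M i); have := ler_norm (M' i).
  have := normr_ge0 (M i); have := normr_ge0 (M' i).
  by rewrite invrK; lra.
exists e^-1; first by rewrite invr_gt0.
move=> t Jt i; have [Me Me'] := eP i.
by split; [exact: le_trans (MP _ _ Jt) Me|exact: le_trans (M'P _ _ Jt) Me'].
Qed.

(** Only the partition points are kept in the closed tube; in between, an Euler segment may leave it
    by [e]. *)
Definition near_tube (e t : R) (x : 'rV[R]_n) :=
  forall i, b i t - e <= x ord0 i <= c i t + e.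

Lemma near_tube_bounded : exists2 M : R, 0 < M & forall t x, J t ->
  near_tube 1 t x -> `|x| <= M.
Proof.
have [M M0 MP] := tube_bounded; exists (M + 1); first by rewrite addr_gt0.
move=> t x Jt tx; apply: norm_le_coord => [|i]; first by rewrite addr_ge0 ?ltW.
have := tx i; have [] := MP _ Jt i; rewrite !ler_norml; lra.
Qed.

Lemma compact_bounded_strip M : compact (J `*` [set x : 'rV[R]_n | `|x| <= M]).
Proof.
apply: compact_setX; first exact: compact_J.
apply: bounded_closed_compact.
  exists M; split; first exact: num_real.
  by move=> e Me x /= xM; apply: le_trans xM (ltW Me).
rewrite (_ : [set _ | _] = (fun x : 'rV[R]_n => `|x|) @^-1` [set y | y <= M]) //.
by apply: closed_comp => [x _|]; [exact: norm_continuous|exact: closed_le].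
Qed.

Lemma strip_continuous M : {within J `*` [set x : 'rV[R]_n | `|x| <= M],
  continuous (fun M : R * 'rV[R]_n => g M.1 M.2)}.
Proof.
by apply: continuous_subspaceW g_continuous => -[t x] /= [/in_J[]].
Qed.

Lemma rhs_unif_continuous M e : 0 < e -> exists2 r : R, 0 < r &
  forall s t x y, J s -> J t -> `|x| <= M -> `|y| <= M -> `|s - t| < r ->
    `|x - y| < r -> `|g s x - g t y| <= e.
Proof.
move=> e0.
have [r r0 rP] :=
  compact_unif_continuous (@compact_bounded_strip M) (@strip_continuous M) e0.
exists r => // s t x y Js Jt xM yM st xy; apply/ltW.
suff : ball (g s x) e (g t y) by rewrite -ball_normE.
apply: (rP (s, x) (t, y)) => //.
by split; rewrite -ball_normE.
Qed.

Lemma rhs_bounded M : exists2 C : R, 0 < C &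
  forall t x, J t -> `|x| <= M -> `|g t x| <= C.
Proof.
have [C [_ CP]] := compact_bounded
  (continuous_compact (@strip_continuous M) (@compact_bounded_strip M)).
exists (`|C| + 1); first by rewrite ltr_wpDl.
move=> t x Jt xM; apply: (CP (`|C| + 1)).
  by rewrite (le_lt_trans (ler_norm _)) // ltrDl.
by exists (t, x).
Qed.

(** * Covering property of a single Euler step *)

Definition box t (l : 'rV[R]_n) : 'rV[R]_n :=
  \row_i (b i t + l ord0 i * (c i t - b i t)).

Lemma box_closure t l : T t -> unit_cube l -> tube_closure b c t (box t l).
Proof.
move=> Tt Ql i; have := Ql i; have := bc i Tt; rewrite mxE => bci /andP[l0 l1].
have w0 : 0 <= c i t - b i t by rewrite subr_ge0 ltW.
rewrite lerDl mulr_ge0 //= -lerBrDl ler_piMl //.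
Qed.

Lemma box_continuous t : continuous (box t).
Proof.
pose C := \sum_i `|c i t - b i t| + 1.
have C0 : 0 < C by rewrite ltr_wpDl // sumr_ge0.
apply: continuous_dist => l e e0; exists (e / C); first by rewrite divr_gt0.
move=> k lk; apply: norm_le_coord => [|i]; first exact: ltW.
rewrite !mxE opprD addrACA subrr add0r -mulrBl normrM.
have le1 : `|l ord0 i - k ord0 i| <= e / C.
  by have := le_norm_coord (l - k) i; rewrite !mxE => /le_trans; apply; exact: ltW.
have le2 : `|c i t - b i t| <= C.
  by rewrite /C (bigD1 i) //= -addrA lerDl addr_ge0 // sumr_ge0.
rewrite -[leRHS](divfK (lt0r_neq0 C0)) ler_pM //.
Qed.

(** The same [l] names corresponding points of two sections, so closeness of [b] and [c] at two
    times moves every point of the section, faces included, by little. *)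
Lemma box_near s t l e : unit_cube l ->
  (forall i, `|b i s - b i t| <= e /\ `|c i s - c i t| <= e) -> 0 <= e ->
  `|box s l - box t l| <= e.
Proof.
move=> Ql st e0; apply: norm_le_coord => // i; rewrite !mxE.
have [] := st i; have /andP[l0 l1] := Ql i; rewrite !ler_norml.
move=> /andP[b1 b2] /andP[c1 c2]; apply/andP; split; nra.
Qed.

Lemma rhs_continuous t : T t -> continuous (g t).
Proof.
move=> Tt; apply: continuous_dist => x e e0.
have /subspace_continuousP/(_ (t, x) (conj Tt I)) := g_continuous.
move=> /within_cvg_distP/(_ _ e0)[r r0 rP]; exists r => // y xy.
apply: (rP (t, y)) => //.
suff : ball (t, x) r (t, y) by rewrite -ball_normE.
by split; [exact: ballxx|rewrite -ball_normE].
Qed.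

Lemma euler_step_onto tau s s' h : T tau -> T s ->
  (forall i l, unit_cube l -> l ord0 i = 0 ->
    b i s + h * g tau (box s l) ord0 i <= b i s') ->
  (forall i l, unit_cube l -> l ord0 i = 1 ->
    c i s' <= c i s + h * g tau (box s l) ord0 i) ->
  forall x', tube_closure b c s' x' ->
  exists2 l, unit_cube l & x' = box s l + h *: g tau (box s l).
Proof.
move=> Ttau Ts lo hi x' x'K.
have Fc : continuous (fun l => box s l + h *: g tau (box s l) - x').
  apply: euler_map_continuous; first exact: box_continuous.
  exact: rhs_continuous.
have [|||l Ql lE] :=
  @poincare_miranda R n (fun l => box s l + h *: g tau (box s l) - x').
- exact: continuous_subspaceT Fc.
- move=> l i Ql li; rewrite !mxE li mul0r addr0.
  have := lo i l Ql li; have := x'K i; lra.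
- move=> l i Ql li; rewrite !mxE li mul1r.
  have := hi i l Ql li; have := x'K i; lra.
- by move/eqP: lE; rewrite subr_eq0 => /eqP lE; exists l.
Qed.


(* Both ends of the step move while the tag stays at [tau]: the increments of
   [b] and [c] are controlled by the straddle lemma. *)
Lemma dense_step tau : J tau -> kappa T tau -> sigma T tau = tau ->
  exists2 d : R, 0 < d & forall s s', J s -> J s' -> tau - d < s <= tau ->
    s < s' -> tau <= s' < tau + d ->
    forall x', tube_closure b c s' x' -> exists2 x, tube_closure b c s x &
      x' = x + (s' - s) *: g tau x.
Proof.
move=> Jtau ktau stau; have [Ttau _] := (in_J tau).1 Jtau.
have gboxc i : continuous (fun l => g tau (box tau l) ord0 i).
  move=> l; apply: (@continuous_comp _ _ _ (fun l => g tau (box tau l))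
    (fun x : 'rV[R]_n => x ord0 i)); last exact: coord_continuous.
  apply: (@continuous_comp _ _ _ (box tau) (g tau)); first exact: box_continuous.
  exact: rhs_continuous.
have gap (i : 'I_n) (a : R) (h : 'rV[R]_n -> R) :
    continuous h -> (forall l, unit_cube l -> l ord0 i = a -> h l < 0) ->
    exists2 e, 0 < e & forall l, unit_cube l -> l ord0 i = a -> h l + e <= 0.
  move=> hc h0; have := @compact_lt0_gap R _ (@unit_cube R n `&` [set l | l ord0 i = a]) h.
  case=> [||l [Ql li]|e e0 eP]; last by exists e => // l Ql li; exact: eP.
  - apply: compact_closedI; first exact: compact_unit_cube.
    by apply: (@closed_comp _ _ (fun l : 'rV[R]_n => l ord0 i) [set a]) => [l _|]; [exact: coord_continuous|exact: closed_eq].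
  - exact: continuous_subspaceT.
  - exact: h0.
(* Each face is compact, so strict egress at [tau] holds with a uniform margin [e]. One half will
   pay for the increments of [b] and [c], the other for replacing [box tau l] by [box s l]. *)
have [e e0 eP] : exists2 e, 0 < e & forall i, (forall l, unit_cube l ->
    l ord0 i = 0 -> g tau (box tau l) ord0 i - db i tau + e <= 0) /\
    (forall l, unit_cube l ->
    l ord0 i = 1 -> dc i tau - g tau (box tau l) ord0 i + e <= 0).
  apply: finite_pos => [i e e' /andP[e'0 ee'] [lo hi]|i].
    split=> l Ql li.
      by have := lo l Ql li; lra.
    by have := hi l Ql li; lra.
  have [|l Ql li|e e0 eP] := gap i 0 (fun l => g tau (box tau l) ord0 i - db i tau).
  - by apply: (@continuous_sub R _ R^o) => //; exact: cst_continuous.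
  - rewrite subr_lt0; apply: lower_egress => //; first exact: box_closure.
    by rewrite mxE li mul0r addr0.
  have [|l Ql li|e' e'0 e'P] := gap i 1 (fun l => dc i tau - g tau (box tau l) ord0 i).
  - by apply: (@continuous_sub R _ R^o) => //; exact: cst_continuous.
  - rewrite subr_lt0; apply: upper_egress => //; first exact: box_closure.
    by rewrite mxE li mul1r addrC subrK.
  exists (Num.min e e'); first by rewrite lt_min e0.
  split=> l Ql li.
    by apply: le_trans (eP _ Ql li); rewrite lerD2l ge_min lexx.
  by apply: le_trans (e'P _ Ql li); rewrite lerD2l ge_min lexx orbT.
have e2 : 0 < e / 2 by rewrite divr_gt0.
have straddle (h dh : 'I_n -> R -> R) :
    (forall i t, kappa T t -> is_delta_derive T (h i : R -> R^o) t (dh i t)) ->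
    exists2 d : R, 0 < d & forall i s, T s -> `|tau - s| < d ->
      `|h i tau - h i s - (tau - s) * dh i tau| <= e / 2 * `|tau - s|.
  move=> hD; apply: finite_pos => [i d d' /andP[_ d'd] dP s Ts sd|i].
    by apply: dP => //; exact: lt_le_trans sd d'd.
  by have := hD i _ ktau _ e2; rewrite stau.
have [M M0 MP] := near_tube_bounded.
have [rg rg0 rgP] := @rhs_unif_continuous M _ e2.
have [ru ru0 ruP] := tube_unif_continuous (divr_gt0 rg0 (ltr0n R 2)).
have [rb rb0 rbP] := straddle b db bD.
have [rc rc0 rcP] := straddle c dc cD.
exists (Num.min (Num.min rb rc) ru); first by rewrite !lt_min rb0 rc0.
move=> s s' Js Js' /andP[]; rewrite ltrBlDr -ltrBlDl !lt_min.
move=> /andP[/andP[sb sc] su] stau' ss' /andP[taus'].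
rewrite -ltrBlDl !lt_min => /andP[/andP[sb' sc'] su'] x' x'K.
have [Ts _] := (in_J s).1 Js; have [Ts' _] := (in_J s').1 Js'.
have ns : `|tau - s| = tau - s by rewrite ger0_norm // subr_ge0.
have ns' : `|tau - s'| = s' - tau by rewrite distrC ger0_norm // subr_ge0.
have gnear l : unit_cube l ->
    `|g tau (box tau l) - g tau (box s l)| <= e / 2.
  move=> Ql; apply: rgP => //.
  - apply: MP Jtau _ => i; have := box_closure Ttau Ql i; lra.
  - apply: MP Js _ => i; have := box_closure Ts Ql i; lra.
  - by rewrite subrr normr0.
  - apply: (@le_lt_trans _ _ (rg / 2)); last by rewrite ltr_pdivrMr // ltr_pMr // ltr1n.
    by apply: box_near => // [i|]; [apply: ruP; rewrite // ns|rewrite ltW // divr_gt0].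
(* As [tau] lies between [s] and [s'], the errors on the two sides add up to [e / 2] times the full
   length [s' - s]. *)
have inc (h dh : 'I_n -> R -> R) (d : R) i : tau - s < d -> s' - tau < d ->
    (forall i s, T s -> `|tau - s| < d ->
      `|h i tau - h i s - (tau - s) * dh i tau| <= e / 2 * `|tau - s|) ->
    `|h i s' - h i s - (s' - s) * dh i tau| <= e / 2 * (s' - s).
  move=> ds ds' hP; have := hP i s Ts; have := hP i s' Ts'; rewrite ns ns'.
  by move=> /(_ ds') h1 /(_ ds); move: h1; rewrite !ler_norml; lra.
have ss0 : 0 < s' - s by rewrite subr_gt0.
have [||l Ql ->] := @euler_step_onto tau s s' (s' - s) Ttau Ts _ _ x' x'K.
- move=> i l Ql li; have := inc b db rb i sb sb' rbP.
  have := (eP i).1 l Ql li; have := le_trans (le_norm_coord _ i) (gnear l Ql).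
  rewrite !mxE !ler_norml; nra.
- move=> i l Ql li; have := inc c dc rc i sc sc' rcP.
  have := (eP i).2 l Ql li; have := le_trans (le_norm_coord _ i) (gnear l Ql).
  rewrite !mxE !ler_norml; nra.
- by exists (box s l) => //; exact: box_closure.
Qed.

(* To the left of [tau] only the continuity of [b] and [c] is available; the
   error it causes is absorbed in a fraction of the jump at [tau]. *)
Lemma scattered_step tau e : J tau -> tau < sigma T tau -> sigma T tau <= t1 -> 0 < e ->
  exists2 d : R, 0 < d & forall s, J s -> tau - d < s <= tau ->
    forall x', tube_closure b c (sigma T tau) x' ->
    exists2 x, tube_closure b c s x &
      `|x' - x - (sigma T tau - s) *: g tau x| <= e * (sigma T tau - s).
Proof.
set mu := sigma T tau - tau => Jtau; rewrite -subr_gt0 -/mu => mu0 st1 e0.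
have [Ttau /andP[t0tau _]] := (in_J tau).1 Jtau.
have Ts := sigma_in closedT Ttau.
have ktau : kappa T tau by apply: kappa_lt Ttau Ts _; rewrite -subr_gt0.
have bs i : b i (sigma T tau) = b i tau + mu * db i tau.
  exact: delta_derive_scattered Ttau (bD i ktau).
have cs i : c i (sigma T tau) = c i tau + mu * dc i tau.
  exact: delta_derive_scattered Ttau (cD i ktau).
have [M M0 MP] := near_tube_bounded.
have [C C0 CP] := rhs_bounded M.
have e3 : 0 < e / 3 by rewrite divr_gt0.
have [rg rg0 rgP] := @rhs_unif_continuous M _ e3.
(* Three errors of size at most [mu * (e / 3)]: the move of the starting point, the change of [g],
   and the extra time [tau - s] at speed at most [C]. *)
pose r := Num.min (rg / 2) (e / 3 * mu).
have r0 : 0 < r by rewrite lt_min divr_gt0 // mulr_gt0.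
have [ru ru0 ruP] := tube_unif_continuous r0.
exists (Num.min ru (e / 3 * mu / C)).
  by rewrite lt_min ru0 divr_gt0 // mulr_gt0.
move=> s Js /andP[]; rewrite ltrBlDr -ltrBlDl lt_min => /andP[sru sC] stau x' x'K.
have [Tss _] := (in_J s).1 Js.
(* The exact jump from [tau] covers the section, since [b] and [c] are affine across it; the same
   parameter [l] is then used at [s]. *)
have [||l Ql x'E] := @euler_step_onto tau tau (sigma T tau) mu Ttau Ttau _ _ x' x'K.
- move=> i l Ql li; rewrite bs lerD2l ler_wpM2l ?ltW //.
  apply: lower_egress => //; first exact: box_closure.
  by rewrite mxE li mul0r addr0.
- move=> i l Ql li; rewrite cs lerD2l ler_wpM2l ?ltW //.
  apply: upper_egress => //; first exact: box_closure.
  by rewrite mxE li mul1r addrC subrK.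
exists (box s l); first exact: box_closure.
have d1 : `|box tau l - box s l| <= r.
  apply: box_near => // [i|]; last exact: ltW.
  by apply: ruP => //; rewrite ger0_norm // subr_ge0.
have bM t : J t -> `|box t l| <= M.
  move=> Jt; have [Tt _] := (in_J t).1 Jt; apply: (MP t) => // i.
  by have := box_closure Tt Ql i; lra.
have d2 : `|g tau (box tau l) - g tau (box s l)| <= e / 3.
  apply: rgP => //; [exact: bM|exact: bM|by rewrite subrr normr0|].
  apply: le_lt_trans d1 _; rewrite (@le_lt_trans _ _ (rg / 2)) //.
    by rewrite ge_min lexx.
  by rewrite ltr_pdivrMr // ltr_pMr // ltr1n.
have -> : x' - box s l - (sigma T tau - s) *: g tau (box s l) =
    (box tau l - box s l) + mu *: (g tau (box tau l) - g tau (box s l)) -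
    (tau - s) *: g tau (box s l).
  have -> : sigma T tau - s = mu + (tau - s) by rewrite /mu; ring.
  by rewrite x'E scalerBr scalerDl; apply/rowP => i; rewrite !mxE; ring.
have n2 : `|mu *: (g tau (box tau l) - g tau (box s l))| <= mu * (e / 3).
  by rewrite normrZ gtr0_norm // ler_wpM2l // ltW.
have n3 : `|(tau - s) *: g tau (box s l)| <= mu * (e / 3).
  rewrite normrZ ger0_norm ?subr_ge0 // mulrC.
  have := ltW sC; rewrite ler_pdivlMr // => /(le_trans _); rewrite [mu * _]mulrC; apply.
  by rewrite mulrC ler_wpM2l ?subr_ge0 // CP // bM.
have n1 : `|box tau l - box s l| <= mu * (e / 3).
  by apply: le_trans d1 _; rewrite ge_min [mu * _]mulrC lexx orbT.
apply: le_trans (ler_normB _ _) _; apply: le_trans (lerD (ler_normD _ _) (lexx _)) _.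
have : mu <= sigma T tau - s by rewrite /mu lerD2l lerN2.
nra.
Qed.

Lemma eps_step tau e : J tau -> 0 < e -> exists2 d : R, 0 < d &
  forall s s', J s -> J s' -> tau - d < s <= tau -> s < s' ->
    s' = sigma T tau \/ (sigma T tau = tau /\ tau <= s' < tau + d) ->
    forall x', tube_closure b c s' x' -> exists2 x, tube_closure b c s x &
      `|x' - x - (s' - s) *: g tau x| <= e * (s' - s).
Proof.
move=> Jtau e0; have [Ttau _] := (in_J tau).1 Jtau.
have [ktau|[tauE ls]] := J_cases Jtau; last first.
  (* This [d] forces [s = t1], after which no later [s'] is left in [J]. *)
  exists (t1 - rho T t1); first by rewrite subr_gt0 ls.2.
  move=> s s' Js Js'; rewrite tauE opprB addrC subrK => /andP[rs _].
  rewrite (J_left_scattered ls Js rs) => t1s'.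
  by have [_ /andP[_]] := (in_J s').1 Js'; rewrite leNgt t1s'.
have [stau|ntau] := eqVneq (sigma T tau) tau.
  have [d d0 dP] := dense_step Jtau ktau stau; exists d => // s s' Js Js' ds ss' h x' x'K.
  have s'h : tau <= s' < tau + d.
    by case: h => [->|[]//]; rewrite stau lexx ltrDl.
  have [x xK ->] := dP s s' Js Js' ds ss' s'h x' x'K; exists x => //.
  by rewrite [x + _]addrC addrK subrr normr0 mulr_ge0 // ltW // subr_gt0.
have tlt : tau < sigma T tau by rewrite lt_neqAle eq_sym ntau sigma_ge.
have [st1|t1s] := leP (sigma T tau) t1; last first.
  exists 1 => // s s' _ Js' _ _ [s'E|[]]; last by move/eqP: ntau.
  by have [_ /andP[_]] := (in_J s').1 Js'; rewrite s'E leNgt t1s.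
have [d d0 dP] := scattered_step Jtau tlt st1 e0; exists d => //.
move=> s s' Js Js' ds ss' [->|[]]; last by move/eqP: ntau.
exact: dP.
Qed.

(* The increment estimate replaces the integral equation: it is stable under
   concatenation, and for [e = 0] it gives the delta derivative of [y]. *)
Definition eps_solution e s (y : R -> 'rV[R]_n) :=
  (forall r, J r -> r <= s -> near_tube e r (y r)) /\
  (forall p q, J p -> J q -> p <= q <= s -> forall v k,
    (forall r, J r -> p <= r < q -> `|g r (y r) - v| <= k) ->
    `|y q - y p - (q - p) *: v| <= (k + e) * (q - p)).

Definition eps_reachable e s := forall x', tube_closure b c s x' ->
  exists2 y, eps_solution e s y & y s = x'.

(** A target [x'] is pulled back to some [x] in the closed section at [s]; a solution that ends at
    [x] is extended by the segment from [x] to [x']. *)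
Lemma eps_reachable_step tau e : J tau -> 0 < e <= 1 -> exists2 d : R, 0 < d &
  forall s s', J s -> J s' -> tau - d < s <= tau -> s < s' ->
    s' = sigma T tau \/ (sigma T tau = tau /\ tau <= s' < tau + d) ->
    eps_reachable e s -> eps_reachable e s'.
Proof.
move=> Jtau /andP[e0 e1]; have [Ttau _] := (in_J tau).1 Jtau.
have e20 : 0 < e / 2 by rewrite divr_gt0.
have [d1 d10 d1P] := eps_step Jtau e20.
have [M M0 MP] := near_tube_bounded.
have [C C0 CP] := rhs_bounded M.
have [rg rg0 rgP] := @rhs_unif_continuous M _ e20.
have [ru ru0 ruP] := tube_unif_continuous e20.
pose D := C + 1; have D0 : 0 < D by rewrite addr_gt0.
(* [m] bounds the displacement along the new segment before [s']: [e / 2] keeps it in [near_tube],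
   and [rg / 2] keeps [g] within [e / 2] of its value at the tag. *)
pose m := Num.min (e / 2) (rg / 2).
have m0 : 0 < m by rewrite lt_min e20 divr_gt0.
pose d := Num.min (Num.min d1 rg) (Num.min (ru / 2) (m / (2 * D))).
exists d; first by rewrite !lt_min d10 rg0 !divr_gt0 // mulr_gt0.
have dd1 : d <= d1 by rewrite /d !ge_min lexx.
have drg : d <= rg by rewrite /d !ge_min lexx orbT.
have dru : 2 * d <= ru.
  by rewrite mulrC -ler_pdivlMr // /d !ge_min lexx !orbT.
have dm : 2 * d * D <= m.
  by rewrite mulrAC mulrC -ler_pdivlMr ?mulr_gt0 // /d !ge_min lexx !orbT.
move=> s s' Js Js' ds ss' s'tau reach x' x'K.
have [Ts _] := (in_J s).1 Js.
have [||x xK xE] := d1P s s' Js Js' _ ss' _ x' x'K.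
- by move: ds => /andP[ds ->]; rewrite andbT; apply: le_lt_trans ds; rewrite lerD2l lerN2.
- case: s'tau => [->|[-> /andP[-> s'd]]]; [by left|right; split=> //=].
  by apply: lt_le_trans s'd _; rewrite lerD2l.
have [y [ynear yinc] ys] := reach x xK.
have ss0 : 0 < s' - s by rewrite subr_gt0.
pose w := (s' - s)^-1 *: (x' - x).
have wE : (s' - s) *: w = x' - x by rewrite /w scalerA divff ?lt0r_neq0 // scale1r.
have wg : `|w - g tau x| <= e / 2.
  by rewrite -(ler_pM2r ss0) mulrC -[X in X * _]gtr0_norm // -(normrZ (s' - s)) scalerBr wE.
have xM : `|x| <= M by apply: (MP s) => // i; have := xK i; lra.
have wD : `|w| <= D.
  rewrite -(subrK (g tau x) w) (le_trans (ler_normD _ _)) // addrC lerD ?CP //.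
  by apply: le_trans wg _; lra.
pose z t := if t <= s then y t else x + (t - s) *: w.
have zlin t : s <= t -> z t = x + (t - s) *: w.
  move=> st; rewrite /z; case: (leP t s) => // ts.
  have -> : t = s by apply/eqP; rewrite eq_le ts.
  by rewrite subrr scale0r addr0.
have zs' : z s' = x' by rewrite zlin ?ltW // wE addrC subrK.
have zy t : t <= s -> z t = y t by rewrite /z => ->.
(* A jump to [sigma T tau] may be long, but [J] has no point strictly between [tau] and it, so every
   intermediate [r] stays near the tag. *)
have close r : J r -> s <= r < s' -> `|tau - r| < d /\ `|r - s| < 2 * d.
  move=> Jr /andP[sr rs']; have [Tr _] := (in_J r).1 Jr.
  rewrite [`|r - s|]ger0_norm ?subr_ge0 //.
  have [/ltW rtau|taur|->] := ltgtP r tau; last by rewrite subrr normr0; split; lra.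
    by rewrite ger0_norm ?subr_ge0 //; split; lra.
  rewrite ltr0_norm ?subr_lt0 //; case: s'tau => [s'E|[_ /andP[_ s'd]]]; last by split; lra.
  by have := sigma_le Tr taur; rewrite -s'E leNgt rs'.
have zx r : J r -> s <= r < s' -> `|z r - x| <= m.
  move=> Jr sr; have [_ rs] := close r Jr sr; case/andP: sr => sr _.
  rewrite zlin // addrC addKr normrZ; apply: le_trans dm.
  by rewrite ler_pM // ltW.
have znear r : J r -> r <= s' -> near_tube e r (z r).
  move=> Jr; have [rs _|sr] := leP r s; first by rewrite zy //; exact: ynear.
  rewrite le_eqVlt => /orP[/eqP ->|rs'] i.
    by rewrite zs'; have := x'K i; lra.
  have srs' : s <= r < s' by rewrite rs' ltW.
  have [_ rs] := close r Jr srs'.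
  have [bb cc] := ruP r s Jr Js (lt_le_trans rs dru) i.
  have := le_trans (le_norm_coord (z r - x) i) (zx r Jr srs').
  rewrite !mxE => zxi; have := xK i; have : m <= e / 2 by rewrite /m ge_min lexx.
  by move: bb cc zxi; rewrite !ler_norml; lra.
have zinc p q v k : J p -> J q -> s <= p -> p <= q <= s' ->
    (forall r, J r -> p <= r < q -> `|g r (z r) - v| <= k) ->
    `|z q - z p - (q - p) *: v| <= (k + e) * (q - p).
  move=> Jp Jq sp /andP[pq qs'] gv.
  have [->|pneq] := eqVneq p q.
    by rewrite !subrr scale0r subrr normr0 mulr0.
  have pltq : p < q by rewrite lt_neqAle pneq.
  have sps' : s <= p < s' by rewrite sp (lt_le_trans pltq).
  have [taup _] := close p Jp sps'.
  rewrite !zlin ?(le_trans sp) //.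
  have -> : x + (q - s) *: w - (x + (p - s) *: w) - (q - p) *: v =
      (q - p) *: (w - v) by apply/rowP => i; rewrite !mxE; ring.
  rewrite normrZ ger0_norm ?subr_ge0 // mulrC ler_wpM2r ?subr_ge0 //.
  (* The slope [w] is constant, so comparing it with [v] at the single time [p] is enough: [e / 2]
     from [w] to [g tau x], [e / 2] from there to [g p (z p)], and [k] to [v]. *)
  have g1 : `|g tau x - g p (z p)| <= e / 2.
    apply: rgP => //; first by apply: (MP p) => // i; have := znear p Jp (le_trans pq qs') i; lra.
      exact: lt_le_trans taup drg.
    rewrite distrC; apply: le_lt_trans (zx p Jp sps') _.
    apply: (@le_lt_trans _ _ (rg / 2)); first by rewrite /m ge_min lexx orbT.
    by rewrite ltr_pdivrMr // ltr_pMr // ltr1n.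
  have g2 : `|g p (z p) - v| <= k by apply: gv; rewrite // lexx.
  have -> : w - v = (w - g tau x) + (g tau x - g p (z p)) + (g p (z p) - v).
    by apply/rowP => i; rewrite !mxE; ring.
  apply: le_trans (ler_normD _ _) _; have := ler_normD (w - g tau x) (g tau x - g p (z p)).
  lra.
exists z => //.
split=> // p q Jp Jq /andP[pq qs'] v k gv.
have [qs|sq] := leP q s.
  rewrite !zy ?(le_trans pq) //; apply: yinc => //; first by rewrite pq.
  by move=> r Jr prq; rewrite -zy ?gv // (le_trans _ qs) // ltW //; case/andP: prq.
have [sp|ps] := leP s p; first by apply: zinc; rewrite // pq.
have h1 : `|z s - z p - (s - p) *: v| <= (k + e) * (s - p).
  rewrite (zy s) // (zy p) ?(ltW ps) //; apply: yinc => //; first by rewrite lexx ltW.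
  move=> r Jr /andP[pr rs]; rewrite -zy ?(ltW rs) // gv // pr /=; exact: lt_trans rs sq.
have h2 : `|z q - z s - (q - s) *: v| <= (k + e) * (q - s).
  apply: zinc => //; first by rewrite (ltW sq).
  by move=> r Jr /andP[sr rq]; rewrite gv // rq andbT (le_trans _ sr) // ltW.
have -> : z q - z p - (q - p) *: v =
    (z s - z p - (s - p) *: v) + (z q - z s - (q - s) *: v).
  by apply/rowP => i; rewrite !mxE; ring.
apply: le_trans (ler_normD _ _) _; lra.
Qed.

Lemma eps_reachable_end e : 0 < e <= 1 -> eps_reachable e t1.
Proof.
(* Cousin's argument on the supremum of the reachable points. *)
move=> e01; have /andP[e0 _] := e01.
have Jt0 : J t0 by apply/in_J; rewrite lexx ltW.
have Jt1 : J t1 by apply/in_J; rewrite lexx ltW.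
pose A := [set t | J t /\ eps_reachable e t].
have At0 : A t0.
  split=> // x' x'K; exists (fun=> x') => //; split.
    move=> r /in_J[_ /andP[t0r _]] rt0.
    have -> : r = t0 by apply/eqP; rewrite eq_le rt0.
    by move=> i; have := x'K i; lra.
  move=> p q /in_J[_ /andP[t0p _]] _ /andP[pq qt0] v k _.
  have pE : p = t0 by apply/eqP; rewrite eq_le t0p (le_trans pq).
  have qE : q = t0 by apply/eqP; rewrite eq_le qt0 -pE.
  by rewrite pE qE !subrr scale0r subrr normr0 mulr0.
have supA : has_sup A.
  split; first by exists t0.
  by exists t1 => t [/in_J[_ /andP[]]].
have ubA t : A t -> t <= sup A by move=> At; apply: ub_le_sup => //; exact: supA.2.
pose tau := sup A.
have Jtau : J tau.
  have : closed J by apply: closedI => //; exact: itv_closed.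
  apply=> U /nbhs_ballP[r /= r0 rU].
  have [s [Js As] sr] := sup_adherent r0 supA.
  exists s; split=> //; apply: rU; rewrite -ball_normE /ball_ /=.
  by rewrite ger0_norm ?subr_ge0 ?ubA // -/tau ltrBlDr -ltrBlDl.
have [Ttau /andP[_ taut1]] := (in_J tau).1 Jtau.
have [d d0 dP] := eps_reachable_step Jtau e01.
have [s [Js reachs] ds] := sup_adherent d0 supA.
have stau : s <= tau by exact: ubA.
have step s' : J s' -> s' = sigma T tau \/ (sigma T tau = tau /\ tau <= s' < tau + d) ->
    tau <= s' -> A s'.
  move=> Js' s'tau taus'; split=> //; have [ss'|s's] := ltP s s'.
    by apply: (dP s s') => //; rewrite ds.
  have -> : s' = s by apply/eqP; rewrite eq_le s's (le_trans stau).
  by [].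
move: taut1; rewrite le_eqVlt => /orP[/eqP tau1|taut1].
  (* The supremum is [t1] and must be shown to be reachable: by a last step ending at its own tag,
     or because reachable points close to an isolated [t1] equal it. *)
  case: t1_end => [ls|st1]; last first.
    by rewrite -tau1; apply: (step tau _ _ _).2 => //; left; rewrite tau1 st1.
  have r0 : 0 < tau - rho T t1 by rewrite tau1 subr_gt0 ls.2.
  have [r [Jr reachr]] := sup_adherent r0 supA.
  by rewrite -/tau opprB addrC subrK => /(J_left_scattered ls Jr) <-.
(* If [tau < t1], a step to a nearby point on the right, or to [sigma T tau], exceeds the
   supremum. *)
have [stau'|ntau] := eqVneq (sigma T tau) tau.
  have d'0 : 0 < Num.min d (t1 - tau) by rewrite lt_min d0 subr_gt0.
  have [|s' Ts' /andP[taus']] := sigma_dense Ttau stau' _ d'0; first by exists t1.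
  rewrite -ltrBlDl lt_min ltrD2r => /andP[s'd s't1].
  have : A s'.
    apply: step; last exact: ltW.
      apply/in_J; split=> //; rewrite (ltW s't1) andbT (le_trans _ (ltW taus')) //.
      by have [_ /andP[]] := (in_J tau).1 Jtau.
    by right; split=> //; rewrite ltW //= -ltrBlDl.
  by move=> /ubA; rewrite -/tau leNgt taus'.
have Tsig : T (sigma T tau) by exact: sigma_in.
have taus : tau < sigma T tau by rewrite lt_neqAle eq_sym ntau sigma_ge.
have : A (sigma T tau).
  apply: step; [|by left|exact: ltW].
  apply/in_J; split=> //; rewrite sigma_le // andbT (le_trans _ (ltW taus)) //.
  by have [_ /andP[]] := (in_J tau).1 Jtau.
by move=> /ubA; rewrite -/tau leNgt taus.
Qed.

(** * Passage to the limit and strict interiority *)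

Lemma eps_solution_limit x1 : tube_closure b c t1 x1 ->
  exists2 y, eps_solution 0 t1 y & y t1 = x1.
Proof.
move=> x1K; have Jt1 : J t1 by apply/in_J; rewrite lexx ltW.
have [M M0 MP] := near_tube_bounded.
have [C C0 CP] := rhs_bounded M.
have ek k : 0 < (k.+1%:R^-1 : R) <= 1 by rewrite invr_gt0 ltr0n /= invf_le1 ?ler1n ?ltr0n.
have /choice [z zP] : forall k, exists z, eps_solution k.+1%:R^-1 t1 z /\ z t1 = x1.
  by move=> k; have [z zs zt] := eps_reachable_end (ek k) x1K; exists z.
have zM k t : J t -> `|z k t| <= M.
  move=> Jt; have [_ /andP[_ tt1]] := (in_J t).1 Jt.
  apply: (MP t) => // i; have /andP[_ k1] := ek k.
  have := (zP k).1.1 t Jt tt1 i; move: k1; move: (k.+1%:R^-1 : R) => d; lra.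
have zC k p q : J p -> J q -> `|z k p - z k q| <= (C + 1) * `|p - q|.
  move=> Jp Jq; wlog pq : p q Jp Jq / p <= q => [wl|].
    have [pq|/ltW qp] := leP p q; first exact: wl.
    by rewrite distrC [`|p - q|]distrC; exact: wl.
  have [_ /andP[_ qt1]] := (in_J q).1 Jq.
  have h : p <= q <= t1 by rewrite pq.
  (* With [v = 0] and [k = C] the increment estimate is a Lipschitz bound, uniform in the index
     since all tolerances are at most 1. *)
  have := (zP k).1.2 p q Jp Jq h 0 C; rewrite scaler0 subr0 => hh.
  rewrite distrC [`|p - q|]distrC [`|q - p|]ger0_norm ?subr_ge0 //.
  apply: le_trans (hh _) _; last first.
    by rewrite ler_wpM2r ?subr_ge0 // lerD2l; case/andP: (ek k).
  by move=> r Jr _; rewrite subr0; apply: CP => //; exact: zM.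
have cB : compact [set x : 'rV[R]_n | forall i, `[- M, M]%classic (x ord0 i)].
  by apply: (@rV_compact R n (fun=> `[- M, M]%classic)) => _; exact: segment_compact.
have zB k t : J t -> [set x : 'rV[R]_n | forall i, `[- M, M]%classic (x ord0 i)] (z k t).
  move=> Jt i; rewrite /= in_itv /= -ler_norml.
  exact: le_trans (le_norm_coord _ i) (zM k t Jt).
have [y yP] := equilipschitz_subsequence compact_J cB zB zC.
have approx e : 0 < e -> exists z, [/\ eps_solution e t1 z, z t1 = x1,
    forall t, J t -> `|z t| <= M & forall t, J t -> `|z t - y t| <= e].
  move=> e0; pose N := Num.truncn e^-1.
  have [k Nk kP] := yP e e0 N; exists (z k); split; [|exact: (zP k).2|exact: zM|exact: kP].
  have ke : k.+1%:R^-1 <= e.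
    rewrite invf_ple ?posrE //; apply/ltW/(lt_le_trans (truncnS_gt _)).
    by rewrite ler_nat ltnS.
  have [near inc] := (zP k).1; split=> [r Jr rt1 i|p q Jp Jq pq v a av].
    by have := near r Jr rt1 i; move: ke; move: (k.+1%:R^-1 : R) => d; lra.
  apply: le_trans (inc p q Jp Jq pq v a av) _.
  by rewrite ler_wpM2r ?subr_ge0 ?lerD2l //; case/andP: pq.
have ynear t : J t -> near_tube 0 t (y t).
  move=> Jt i; have [_ /andP[_ tt1]] := (in_J t).1 Jt.
  have yi e : 0 < e -> b i t - y t ord0 i <= e /\ y t ord0 i - c i t <= e.
    move=> e0; have e20 : 0 < e / 2 by rewrite divr_gt0.
    have [w [ws _ _ wy]] := approx _ e20.
    have := ws.1 t Jt tt1 i; have := le_trans (le_norm_coord _ i) (wy t Jt).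
    by rewrite !mxE ler_norml; split; lra.
  rewrite subr0 addr0 -subr_le0 -[_ <= c i t]subr_le0; apply/andP.
  by split; apply/ler_addgt0Pr => e /yi[]; rewrite add0r.
have yM t : J t -> `|y t| <= M.
  by move=> Jt; apply: (MP t) => // i; have := ynear t Jt i; lra.
exists y; last first.
  apply/eqP; rewrite eq_sym -subr_eq0 -normr_le0; apply/ler_addgt0Pr => e e0.
  by rewrite add0r; have [w [_ <- _]] := approx e e0; exact.
split=> [r Jr _|p q Jp Jq pq v a av]; first exact: ynear.
have qp0 : 0 <= q - p by rewrite subr_ge0; case/andP: pq.
have D0 : 0 < 2 * (q - p) + 2 by rewrite ltr_wpDl // mulr_ge0.
rewrite addr0; apply/ler_addgt0Pr => e e0.
(* One [h] for each endpoint, and [2 * h] per unit of time: one for evaluating [g] along [y] instead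
   of [w], one for the tolerance of [w]. *)
pose h := e / (2 * (q - p) + 2); have h0 : 0 < h by rewrite divr_gt0.
have [rg rg0 rgP] := @rhs_unif_continuous M _ h0.
have m0 : 0 < Num.min h (rg / 2) by rewrite lt_min h0 divr_gt0.
have [w [ws _ wM wy]] := approx _ m0.
have wyh t : J t -> `|w t - y t| <= h.
  by move=> Jt; apply: le_trans (wy t Jt) _; rewrite ge_min lexx.
have inc : `|w q - w p - (q - p) *: v| <= (a + 2 * h) * (q - p).
  apply: le_trans (ws.2 p q Jp Jq pq v (a + h) _) _ => [r Jr prq|]; last first.
    by rewrite ler_wpM2r // mulr_natl mulr2n addrA lerD2l ge_min lexx.
  rewrite -[g r _](subrK (g r (y r))) -addrA addrC (le_trans (ler_normD _ _)) //.
  rewrite lerD ?av // rgP ?wM ?yM // ?subrr ?normr0 //.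
  apply: le_lt_trans (wy r Jr) _; apply: (@le_lt_trans _ _ (rg / 2)).
    by rewrite ge_min lexx orbT.
  by rewrite ltr_pdivrMr // ltr_pMr // ltr1n.
have -> : y q - y p - (q - p) *: v =
    (w q - w p - (q - p) *: v) - (w q - y q) + (w p - y p).
  by apply/rowP => i; rewrite !mxE; ring.
have hE : h * (2 * (q - p) + 2) = e by rewrite /h divfK // lt0r_neq0.
apply: le_trans (ler_normD _ _) _.
have := ler_normB (w q - w p - (q - p) *: v) (w q - y q).
have := wyh q Jq; have := wyh p Jp; lra.
Qed.

Lemma in_open_tube y : eps_solution 0 t1 y -> tube b c t1 (y t1) ->
  forall t, J t -> tube b c t (y t).
Proof.
move=> [near inc] yt1 t Jt; have [Tt /andP[t0t tt1]] := (in_J t).1 Jt.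
have yK s : J s -> tube_closure b c s (y s).
  move=> Js i; have [_ /andP[_ st1]] := (in_J s).1 Js.
  by have := near s Js st1 i; lra.
move: tt1; rewrite le_eqVlt => /orP[/eqP -> //|tlt1].
have kt : kappa T t by exact: kappa_lt Tt Tt1 tlt1.
pose G := g t (y t).
have sJ s : T s -> t < s -> s <= t1 -> J s.
  by move=> Ts ts st1; apply/in_J; rewrite st1 (le_trans t0t) ?ltW.
have scattered : t < sigma T t -> J (sigma T t) /\
    y (sigma T t) = y t + (sigma T t - t) *: G.
  move=> ts; have Js : J (sigma T t).
    by apply: sJ => //; [exact: sigma_in|exact: sigma_le].
  split=> //; apply/eqP; rewrite -subr_eq0 opprD addrA -normr_le0.
  have [_ /andP[_ st1]] := (in_J _).1 Js.
  have h : t <= sigma T t <= t1 by rewrite ltW.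
  have := inc t (sigma T t) Jt Js h G 0; rewrite addr0 mul0r; apply.
  move=> r Jr /andP[]; rewrite le_eqVlt => /orP[/eqP <- _|tr]; first by rewrite subrr normr0.
  have [Tr _] := (in_J r).1 Jr.
  by rewrite ltNge sigma_le.
have dense e : sigma T t = t -> 0 < e -> exists2 r : R, 0 < r & forall s, J s ->
    t < s < t + r -> `|y s - y t - (s - t) *: G| <= e * (s - t).
  move=> st e0; have [M M0 MP] := near_tube_bounded.
  have yM s : J s -> `|y s| <= M.
    by move=> Js; apply: (MP s) => // i; have := yK s Js i; lra.
  have [C C0 CP] := rhs_bounded M.
  have [rg rg0 rgP] := @rhs_unif_continuous M _ e0.
  exists (Num.min rg (rg / C)); first by rewrite lt_min rg0 divr_gt0.
  move=> s Js /andP[ts]; rewrite -ltrBlDl lt_min => /andP[srg sC].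
  have [_ /andP[_ st1]] := (in_J s).1 Js.
  have h : t <= s <= t1 by rewrite ltW.
  have := inc t s Jt Js h G e; rewrite addr0; apply=> r Jr /andP[tr rs].
  have [_ /andP[_ rt1]] := (in_J r).1 Jr.
  rewrite distrC; apply: rgP; rewrite ?yM //.
    by rewrite distrC ger0_norm ?subr_ge0 //; lra.
  have h' : t <= r <= t1 by rewrite tr.
  have := inc t r Jt Jr h' 0 C; rewrite addr0 scaler0 subr0 distrC => hh.
  apply: le_lt_trans (hh _) _.
    by move=> r' Jr' _; rewrite subr0 CP ?yM.
  rewrite mulrC -ltr_pdivlMr //; lra.
(* The sign [sg] treats the lower face ([h = b i], [sg = 1]) and the upper face ([h = c i],
   [sg = -1]) together. *)
have no_exit (d : R) (h : R -> R) i (sg : R) : sg = 1 \/ sg = -1 ->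
    is_delta_derive T (h : R -> R^o) t d -> y t ord0 i = h t ->
    0 < sg * (d - G ord0 i) -> (forall s, J s -> 0 <= sg * (y s ord0 i - h s)) ->
    False.
  move=> sgE hd yh dG inside; have [st|nst] := eqVneq (sigma T t) t; last first.
    have tlt : t < sigma T t by rewrite lt_neqAle eq_sym nst sigma_ge.
    have [Js yE] := scattered tlt; have := inside _ Js.
    have hE : h (sigma T t) = h t + (sigma T t - t) * d.
      exact: delta_derive_scattered Tt hd.
    rewrite yE hE !mxE yh; have : 0 < sigma T t - t by rewrite subr_gt0.
    by move: (sigma T t - t) => mu mu0; have := mulr_gt0 mu0 dG; lra.
  (* A third of the margin: the expansions of [y] and of [h] use one third each, and the last third
     forces the exit. *)
  pose e := sg * (d - G ord0 i) / 3; have e0 : 0 < e by rewrite divr_gt0.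
  have [r r0 rP] := dense e st e0.
  have [r' r'0 r'P] := hd e e0.
  have m0 : 0 < Num.min (Num.min r r') (t1 - t) by rewrite !lt_min r0 r'0 subr_gt0.
  have [|s Ts /andP[ts]] := sigma_dense Tt st _ m0; first by exists t1.
  rewrite -ltrBlDl !lt_min ltrD2r => /andP[/andP[sr sr'] st1].
  have Js := sJ s Ts ts (ltW st1).
  have ns : `|t - s| = s - t by rewrite distrC ger0_norm // subr_ge0 ltW.
  have hs : `|h t - h s - (t - s) * d| <= e * (s - t).
    by rewrite -ns; have := r'P s Ts; rewrite st; apply; rewrite ns.
  have tsr : t < s < t + r by rewrite ts -ltrBlDl.
  have := le_trans (le_norm_coord _ i) (rP s Js tsr).
  have := inside s Js; have st0 : 0 < s - t by rewrite subr_gt0.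
  have := mulr_gt0 st0 dG; move: hs; rewrite !mxE yh /e !ler_norml.
  by case: sgE => ->; lra.
move=> i; have /andP[by_ yc] := yK t Jt i; rewrite !lt_neqAle by_ yc !andbT.
apply/andP; split; apply/eqP => yE.
  apply: (no_exit (db i t) (b i) i 1) => //; first by left.
  - exact: bD.
  - by rewrite mul1r subr_gt0; apply: lower_egress => //; exact: yK.
  - by move=> s Js; rewrite mul1r subr_ge0; case/andP: (yK s Js i).
apply: (no_exit (dc i t) (c i) i (-1)) => //; first by right.
- exact: cD.
- by rewrite mulN1r opprB subr_gt0; apply: upper_egress => //; exact: yK.
- by move=> s Js; rewrite mulN1r opprB subr_ge0; case/andP: (yK s Js i).
Qed.

Lemma solution_in_tube : exists y : R -> 'rV[R]_n, exists2 C : R, 0 < C &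
  [/\ forall t, J t -> tube b c t (y t),
      forall p q, J p -> J q -> `|y p - y q| <= C * `|p - q| &
      forall p q, J p -> J q -> p <= q -> forall v k,
        (forall r, J r -> p <= r < q -> `|g r (y r) - v| <= k) ->
        `|y q - y p - (q - p) *: v| <= k * (q - p)].
Proof.
(* The midpoint of the last section; any terminal value in the open section would serve. *)
pose x1 : 'rV[R]_n := \row_i ((b i t1 + c i t1) / 2).
have x1K : tube b c t1 x1.
  by move=> i; rewrite mxE; have := bc i Tt1; lra.
have [|y ys yt1] := @eps_solution_limit x1.
  by move=> i; have /andP[/ltW -> /ltW ->] := x1K i.
have yK : forall t, J t -> tube b c t (y t).
  by apply: in_open_tube => //; rewrite yt1.
have inc p q : J p -> J q -> p <= q -> forall v k,
    (forall r, J r -> p <= r < q -> `|g r (y r) - v| <= k) ->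
    `|y q - y p - (q - p) *: v| <= k * (q - p).
  move=> Jp Jq pq v k gv; have [_ /andP[_ qt1]] := (in_J q).1 Jq.
  have h : p <= q <= t1 by rewrite pq.
  by have := ys.2 p q Jp Jq h v k gv; rewrite addr0.
have [M M0 MP] := near_tube_bounded.
have [C C0 CP] := rhs_bounded M.
exists y, C => //; split=> // p q Jp Jq.
wlog pq : p q Jp Jq / p <= q => [wl|].
  have [pq|/ltW qp] := leP p q; first exact: wl.
  by rewrite distrC [`|p - q|]distrC; exact: wl.
rewrite distrC [`|p - q|]distrC [`|q - p|]ger0_norm ?subr_ge0 //.
have := inc p q Jp Jq pq 0 C; rewrite scaler0 subr0; apply=> r Jr _.
rewrite subr0; apply: CP => //; apply: (MP r) => // i.
by have := yK r Jr i; lra.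
Qed.

End StrictEgress.

(** * Solutions of the inclusion *)

Lemma delta_outer0 (R : realType) (T : set R) : T !=set0 -> delta_outer T set0 = 0%E.
Proof.
move=> [t Tt]; apply/eqP; rewrite eq_le; apply/andP; split.
  apply: ereal_inf_lbound; exists (fun=> t), (fun=> t); split=> //.
  by rewrite eseries0 // => k _ _; rewrite subrr.
apply: le_ereal_inf_tmp => _ [a [b [ab _ ->]]].
by apply: nneseries_ge0 => k _ _; rewrite lee_fin subr_ge0; have [] := ab k.
Qed.

Lemma lipschitz_delta_absolutely_continuous (R : realType) (V : normedModType R)
    (T : set R) (y : R -> V) C :
  (forall p q, T p -> T q -> `|y p - y q| <= C * `|p - q|) ->
  delta_absolutely_continuous T y.
Proof.
move=> yC e e0; pose D := `|C| + 1; have D0 : 0 < D by rewrite ltr_wpDl.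
exists (e / D); first by rewrite divr_gt0.
move=> N a b ab _ sr; apply: (@le_lt_trans _ _ (D * \sum_(k < N) (b k - a k))).
  rewrite mulr_sumr; apply: ler_sum => k _; have [Ta Tb abk] := ab k.
  rewrite -[X in _ * X]ger0_norm ?subr_ge0 //.
  apply: le_trans (yC _ _ Tb Ta) _; rewrite ler_wpM2r //.
  by rewrite (le_trans (ler_norm _)) // lerDl.
by rewrite mulrC -ltr_pdivlMr.
Qed.

Section DeltaDeriveUnique.
Variables (R : realType) (V : normedModType R) (T : set R) (y : R -> V) (t : R).

Lemma delta_deriveP : delta_derivable T y t ->
  is_delta_derive T y t (delta_derive T y t).
Proof. by move=> yd; exact: (xgetPex point yd). Qed.

Lemma delta_derive_unique d d' :
  (forall r : R, 0 < r -> exists s, [/\ T s, `|t - s| < r & s != sigma T t]) ->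
  is_delta_derive T y t d -> is_delta_derive T y t d' -> d = d'.
Proof.
move=> acc yd yd'; apply/eqP; rewrite -subr_eq0 -normr_le0.
apply/ler_addgt0Pr => e e0; rewrite add0r.
have e20 : 0 < e / 2 by rewrite divr_gt0.
have [r r0 rP] := yd _ e20; have [r' r'0 r'P] := yd' _ e20.
have [|s [Ts]] := acc (Num.min r r'); first by rewrite lt_min r0.
rewrite lt_min => /andP[sr sr'] ss.
have s0 : 0 < `|sigma T t - s| by rewrite normr_gt0 subr_eq0 eq_sym.
rewrite -(ler_pM2l s0) -normrZ scalerBr.
have -> : (sigma T t - s) *: d - (sigma T t - s) *: d' =
    (y (sigma T t) - y s - (sigma T t - s) *: d') -
    (y (sigma T t) - y s - (sigma T t - s) *: d).
  by rewrite [in RHS]opprB [RHS]addrC addrA subrK.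
apply: le_trans (ler_normB _ _) _.
have := rP s Ts sr; have := r'P s Ts sr'; lra.
Qed.

(** A right-scattered [t] is its own witness, a right-dense one is approached from the right, and a
    maximum outside the removed set from the left. The point [u] excludes a one-point time scale. *)
Lemma kappa_accumulation u : kappa T t -> T u -> u != t ->
  forall r : R, 0 < r -> exists s, [/\ T s, `|t - s| < r & s != sigma T t].
Proof.
move=> [Tt nls] Tu ut r r0.
have [st|st] := eqVneq (sigma T t) t; last first.
  by exists t; rewrite subrr normr0 eq_sym.
have [ex|nex] := pselect (exists2 s, T s & t < s).
  have [s Ts /andP[ts sr]] := sigma_dense Tt st ex r0.
  exists s; rewrite st; split=> //; last by rewrite gt_eqF.
  by rewrite distrC ger0_norm ?subr_ge0 ?ltW // ltrBlDl.
have tmax s : T s -> s <= t.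
  by move=> Ts; rewrite leNgt; apply/negP => ts; apply: nex; exists s.
have hs : has_sup [set s | T s /\ s < t].
  split; first by exists u; split=> //; rewrite lt_neqAle ut tmax.
  by exists t => s /= [Ts /ltW].
have [s [Ts slt] rs] := sup_adherent r0 hs.
exists s; rewrite st; split=> //; last by rewrite lt_eqF.
rewrite ger0_norm ?subr_ge0 ?(ltW slt) //.
have : t <= rho T t by rewrite leNgt; apply/negP => rt; apply: nls; split.
rewrite /rho; case: pselect => /= [ne tr|[]]; last by exists u; split=> //; rewrite lt_neqAle ut tmax.
by rewrite ltrBlDl -ltrBlDr; apply: le_lt_trans rs; rewrite lerD2r.
Qed.

Lemma delta_derive_of_increments (G : R -> V) : closed T -> T t ->
  (forall p q, T p -> T q -> p <= q -> forall v k,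
    (forall r, T r -> p <= r < q -> `|G r - v| <= k) ->
    `|y q - y p - (q - p) *: v| <= k * (q - p)) ->
  (forall e, 0 < e -> exists2 r : R, 0 < r &
    forall s, T s -> `|t - s| < r -> `|G s - G t| <= e) ->
  is_delta_derive T y t (G t).
Proof.
move=> cT Tt inc Gc e e0; have [r r0 rP] := Gc e e0.
have Ts := sigma_in cT Tt; have ts := sigma_ge Tt.
(* At a right-scattered [t] the window is cut at the graininess, so that it contains no point of [T]
   to the right of [t]. *)
pose r' := if t < sigma T t then Num.min r (sigma T t - t) else r.
have r'0 : 0 < r' by rewrite /r'; case: ifP => // h; rewrite lt_min r0 subr_gt0.
have r'r : r' <= r by rewrite /r'; case: ifP => // _; rewrite ge_min lexx.
(* Between [t] and [sigma T t] the only time to test is [t] itself, so the estimate applies with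
   [k = 0]. *)
have yE : y (sigma T t) = y t + (sigma T t - t) *: G t.
  apply/eqP; rewrite -subr_eq0 opprD addrA -normr_le0.
  have := inc _ _ Tt Ts ts (G t) 0.
  rewrite mul0r; apply=> s Tss /andP[]; rewrite le_eqVlt => /orP[/eqP <- _|lts].
    by rewrite subrr normr0.
  by rewrite ltNge sigma_le.
exists r' => // s Tss tsr'; have [st|lts] := leP s t.
  have -> : y (sigma T t) - y s - (sigma T t - s) *: G t = y t - y s - (t - s) *: G t.
    have -> : (sigma T t - s) *: G t = (sigma T t - t) *: G t + (t - s) *: G t.
      by rewrite -scalerDl; congr (_ *: _); ring.
    by rewrite yE opprD !addrA [y t + _ - y s]addrAC addrK.
  apply: le_trans (inc s t Tss Tt st (G t) e _) _.
    move=> q Tq /andP[sq qt]; apply: rP => //; apply: lt_le_trans r'r.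
    apply: le_lt_trans tsr'; rewrite ger0_norm ?subr_ge0 ?(ltW qt) //.
    by rewrite ger0_norm ?subr_ge0 // lerD2l lerN2.
  by rewrite ler_wpM2l ?(ltW e0) // ger0_norm ?subr_ge0 ?(le_trans st) // lerD2r.
have st : sigma T t = t.
  apply/eqP; rewrite eq_le ts andbT leNgt; apply/negP => tlt.
  move: tsr'; rewrite /r' tlt lt_min => /andP[_].
  by rewrite distrC ger0_norm ?subr_ge0 ?ltW // ltrD2r ltNge sigma_le.
rewrite st.
have -> : y t - y s - (t - s) *: G t = - (y s - y t - (s - t) *: G t).
  by rewrite -[t - s]opprB scaleNr opprK opprD opprB opprK.
rewrite normrN [`|t - s|]distrC [`|s - t|]ger0_norm ?subr_ge0 ?(ltW lts) //.
apply: inc => // [|q Tq /andP[tq qs]]; first exact: ltW.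
apply: rP => //; apply: lt_le_trans r'r; apply: le_lt_trans tsr'.
rewrite distrC [`|t - s|]distrC ger0_norm ?subr_ge0 //.
by rewrite ger0_norm ?subr_ge0 ?(ltW lts) // lerD2r ltW.
Qed.

End DeltaDeriveUnique.

Theorem theorem17 (R : realType) (n m : nat) (T : set R) (t0 t1 : R)
    (b c : 'I_n -> R -> R)
    (U : set 'rV[R]_m) (f : R -> 'rV[R]_n -> 'rV[R]_m -> 'rV[R]_n)
    (u : R -> 'rV[R]_m) (fu : R -> 'rV[R]_n -> 'rV[R]_n)
    (HT : time_scale T) (Ht0 : T t0) (Ht1 : T t1) (Ht01 : t0 < t1)
    (Hb : forall i t, kappa T t -> delta_derivable T (b i : R -> R^o) t)
    (Hc : forall i t, kappa T t -> delta_derivable T (c i : R -> R^o) t)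
    (Hbc : forall i t, T t -> b i t < c i t)
    (HU : compact U)
    (Hf_time : rd_continuous_time T b c U f)
    (Hf_space : continuously_differentiable_space T b c U f)
    (Hu : admissible_control T U u)
    (Hfu : forall t x, graph T b c (t, x) -> fu t x = f t x (u t))
    (Hfu_cont : {within T `*` setT,
                 continuous (fun M : R * 'rV[R]_n => fu M.1 M.2)})
    (Hfu_reg : locally_regular T b c fu)
    (Hegress : forall M, graph_boundary T b c M -> kappa T M.1 ->
                 delta_strict_egress T b c fu M) :
  exists2 x0 : 'rV[R]_n, tube b c t0 x0 &
    exists2 x : R -> 'rV[R]_n,
      inclusion_solution T t0 t1 (rhs_set U f) x0 x &
      forall t, T t -> t0 <= t <= t1 -> graph T b c (t, x t).
Proof.
have [_ cT] := HT.
(* The tube is followed up to [t2], so that [t1] may be left-dense and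
   right-scattered. *)
pose t2 := sigma T t1; have Tt2 : T t2 by exact: sigma_in.
have t12 : t1 <= t2 by exact: sigma_ge.
have t02 : t0 < t2 by exact: lt_le_trans Ht01 t12.
have t2_end : left_scattered T t2 \/ sigma T t2 = t2.
  have [t2E|t2neq] := eqVneq t2 t1.
    by right; rewrite [in LHS]t2E.
  have lt12 : t1 < t2 by rewrite lt_neqAle eq_sym t2neq.
  left; split=> //; apply: (le_lt_trans _ lt12).
  rewrite /rho; case: pselect => /= [ne|[]]; last by exists t1.
  apply: ge_sup => // s [Ts st2]; rewrite leNgt; apply/negP => t1s.
  by move: st2; rewrite ltNge sigma_le.
have bD i t : kappa T t ->
    is_delta_derive T (b i : R -> R^o) t (delta_derive T (b i : R -> R^o) t).
  by move=> /(Hb i); exact: delta_deriveP.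
have cD i t : kappa T t ->
    is_delta_derive T (c i : R -> R^o) t (delta_derive T (c i : R -> R^o) t).
  by move=> /(Hc i); exact: delta_deriveP.
have lower i t x : kappa T t -> tube_closure b c t x -> x ord0 i = b i t ->
    fu t x ord0 i < delta_derive T (b i : R -> R^o) t.
  move=> kt xK xi; have [Tt _] := kt; apply: (Hegress (t, x) _ kt i).1 => //.
  by split=> //; split=> // /(_ i); rewrite xi ltxx.
have upper i t x : kappa T t -> tube_closure b c t x -> x ord0 i = c i t ->
    delta_derive T (c i : R -> R^o) t < fu t x ord0 i.
  move=> kt xK xi; have [Tt _] := kt; apply: (Hegress (t, x) _ kt i).2 => //.
  by split=> //; split=> // /(_ i); rewrite xi ltxx andbF.
have [y [C C0 [yK yC inc]]] :=
  solution_in_tube cT Ht0 Tt2 t02 bD cD Hbc Hfu_cont lower upper t2_end.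
set J := T `&` `[t0, t1].
have J2 t : J t -> (T `&` `[t0, t2]) t.
  move=> [Tt]; rewrite /= in_itv /= => /andP[t0t tt1].
  by split; rewrite //= in_itv /= t0t (le_trans tt1).
have Jt0 : J t0 by split=> //; rewrite /= in_itv /= lexx ltW.
have Jt1 : J t1 by split=> //; rewrite /= in_itv /= lexx ltW.
have cJ : closed J by apply: closedI => //; exact: itv_closed.
have yD t : J t -> is_delta_derive J y t (fu t (y t)).
  move=> Jt; have [Tt _] := Jt.
  apply: (@delta_derive_of_increments _ _ _ _ _ (fun t => fu t (y t))) => //.
    move=> p q Jp Jq pq v k gv; apply: inc => // [||r [Tr]]; [exact: J2|exact: J2|].
    rewrite /= in_itv /= => /andP[t0r rt2] /andP[pr rq]; apply: gv; last by rewrite pr.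
    have [_ /=] := Jq; rewrite in_itv /= => /andP[_ qt1].
    by split=> //; rewrite /= in_itv /= t0r (le_trans (ltW rq)).
  move=> e e0.
  have /subspace_continuousP/(_ (t, y t) (conj Tt I)) := Hfu_cont.
  move=> /within_cvg_distP/(_ _ e0)[r r0 rP].
  exists (Num.min r (r / C)); first by rewrite lt_min r0 divr_gt0.
  move=> s Js; rewrite lt_min => /andP[sr sC]; rewrite distrC.
  apply: (rP (s, y s)); first by split=> //; case: Js.
  suff : ball (t, y t) r (s, y s) by rewrite -ball_normE.
  split; rewrite -ball_normE //; apply: le_lt_trans (yC _ _ (J2 _ Jt) (J2 _ Js)) _.
  by rewrite mulrC -ltr_pdivlMr.
exists (y t0); first exact: yK (J2 _ Jt0).
exists y; last first.
  move=> t Tt tt; split=> //; apply: yK; apply: J2.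
  by split; rewrite //= in_itv.
split=> //.
  apply: lipschitz_delta_absolutely_continuous => p q Jp Jq.
  by apply: yC; exact: J2.
(* The exceptional set is empty: the derivative exists and lies in [F] at every point of
   [kappa J]. *)
rewrite /delta_negligible -(delta_outer0 (ex_intro _ t0 Ht0)); congr delta_outer.
apply/seteqP; split=> // t [kt]; apply.
have [Jt _] := kt; have [Tt _] := Jt.
(* [J] contains both [t0] and [t1], so [t] is not alone; uniqueness then identifies the chosen value
   [delta_derive J y t] with [fu t (y t)]. *)
have [w Jw wt] : exists2 w, J w & w != t.
  by have [<-|] := eqVneq t0 t; [exists t1; rewrite // gt_eqF|exists t0].
have dE : delta_derive J y t = fu t (y t).
  apply: (delta_derive_unique (kappa_accumulation kt Jw wt)); last exact: yD.
  by apply: delta_deriveP; exists (fu t (y t)); exact: yD.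
split; first by exists (fu t (y t)); exact: yD.
rewrite dE Hfu; last by split=> //; exact: yK (J2 _ Jt).
by exists (u t) => //; have [_ _] := Hu; apply.
Qed.
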